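(* Let $d=2^L$ with $L\ge 1$, let $p^*:[n_1]\times\cdots\times[n_d]\to\mathbb{R}$ be a probability mass function, let $y^1,\dots,y^N$ be i.i.d. samples from $p^*$ with empirical distribution $\hat p$, and let $S_k^{(l)},T_k^{(l)}$ ($l\in[L]$, $k\in[2^l]$) be sketch matrices. Let $\tilde p$ be the hierarchical tensor-network estimator built from $\hat p$, with truncation ranks $r^{(l)}\le\tilde r^{(l)}$, as defined in the context. Suppose that: (i) $p^*$ is represented by a hierarchical tensor-network with ranks $\{r^{(l)}\}_{l=1}^L$, i.e. $\operatorname{rank}\big(p^*(\mathcal I_k^{(l)};\mathcal J_k^{(l)})\big)=r^{(l)}$ for all $l\in[L]$, $k\in[2^l]$; (ii) for all $l\in[L]$, $k\in[2^l]$: $\mathrm{Range}\big(p^*(\mathcal I_k^{(l)};\mathcal J_k^{(l)})T_k^{(l)}\big)=\mathrm{Range}\big(p^*(\mathcal I_k^{(l)};\mathcal J_k^{(l)})\big)$ and $\mathrm{Range}\big(p^*(\mathcal I_k^{(l)};\mathcal J_k^{(l)})^TS_k^{(l)}\big)=\mathrm{Range}\big(p^*(\mathcal I_k^{(l)};\mathcal J_k^{(l)})^T\big)$; (iii) for all $l\in[L]$, $k\in[2^{l-1}]$: $\mathrm{Range}\big(p_{2k-1}^{(l)*}\big)\supset\mathrm{Range}\big(p_k^{(l-1)*}(\mathcal I_{2k-1}^{(l)};\mathcal I_{2k}^{(l)},\tilde\gamma_k^{(l-1)})\big)$ and $\mathrm{Range}\big(p_{2k}^{(l)*}\big)\supset\mathrm{Range}\big(p_k^{(l-1)*}(\mathcal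 I_{2k}^{(l)};\mathcal I_{2k-1}^{(l)},\tilde\gamma_k^{(l-1)})\big)$; (iv) for all $l\in[L]$, $k\in[2^l]$ and $i,j\in[\tilde r^{(l)}]$: $\langle S_k^{(l)}(:,i),S_k^{(l)}(:,j)\rangle=\delta_{ij}$ and $\langle T_k^{(l)}(:,i),T_k^{(l)}(:,j)\rangle=\delta_{ij}$. Let $c_{A^\dagger},c_{\hat A^\dagger},c_p,c_{\tilde p}$ be upper bounds such that, for all $l\in[L]$, $k\in[2^l]$, $$\|(A_k^{(l)*})^\dagger\|_2\le c_{A^\dagger},\quad \|(\mathcal P_{r^{(l)}}(\hat A_k^{(l)}))^\dagger\|_2\le c_{\hat A^\dagger},\quad \|p_k^{(l)*}\|_F\le c_p,\quad \|\tilde p_k^{(l)}\|_F\le c_{\tilde p},$$ and also $\|p^*\|_F\le c_p$. Put $\tilde r_{\max}=\max_{l}\tilde r^{(l)}$. Then for any $0<\delta<1$, when $c_{A^\dagger}^2c_pc_{\tilde p}+c_{A^\dagger}^2c_p^2>1$, the following inequality holds with probability at least $1-\delta$: $$\|\tilde p-p^*\|_F\le \tilde C\,\big(c_{A^\dagger}^2c_pc_{\tilde p}+c_{A^\dagger}^2c_p^2\big)^{\log_2 d}\;\frac{\log\!\big(\frac{2\tilde r_{\max}d\log_2 d}{\delta}\big)}{\sqrt N},$$ where $$\tilde C=3\sqrt{\tilde r_{\max}}\left(1+\frac{c_{\tilde p}^2\big(c_{\hat A^\dagger}^2+6c_{A^\dagger}c_{\hat A^\dagger}^2c_p+6c_{A^\dagger}^2c_{\hat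 A^\dagger}c_p\big)}{c_{A^\dagger}^2c_pc_{\tilde p}+c_{A^\dagger}^2c_p^2-1}\right).$$
   Context: Notation. $[n]=\{1,\dots,n\}$. $d=2^L$. For $0\le l\le L$ and $k\in[2^l]$, $\mathcal C_k^{(l)}=\{(k-1)2^{L-l}+1,\dots,k2^{L-l}\}$, so $\mathcal C_k^{(l)}=\mathcal C_{2k-1}^{(l+1)}\cup\mathcal C_{2k}^{(l+1)}$. $\mathcal I_k^{(l)}=\prod_{i\in\mathcal C_k^{(l)}}[n_i]$ and $\mathcal J_k^{(l)}=\prod_{i\in[d]\setminus\mathcal C_k^{(l)}}[n_i]$, so $\mathcal I_k^{(l)}=\mathcal I_{2k-1}^{(l+1)}\times\mathcal I_{2k}^{(l+1)}$. For $p:[n_1]\times\cdots\times[n_d]\to\mathbb R$, $p(\mathcal I_k^{(l)};\mathcal J_k^{(l)})$ is the unfolding matrix of $p$ with rows indexed by $\mathcal I_k^{(l)}$ and columns by $\mathcal J_k^{(l)}$. In general a semicolon separates row multi-indices from column multi-indices; e.g. $q(\mathcal I_{2k-1}^{(l)};\mathcal I_{2k}^{(l)},\tilde\gamma)$ is the matrix with rows $\mathcal I_{2k-1}^{(l)}$ and columns all pairs (element of $\mathcal I_{2k}^{(l)}$, value of $\tilde\gamma$). Range means column space. $M^\dagger$ is the Moore–Penrose pseudo-inverse, $\|\cdot\|_2$ the spectral norm, $\|\cdot\|_F$ the Frobenius norm (for tensors: square root of the sum of squared entries). $\mathcal P_r(M)$ is the best rank-$r$ approximation to $M$ in terms of the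 spectral norm. Sketches. For $l\in[L]$, $k\in[2^l]$: $S_k^{(l)}$ is a real matrix with rows indexed by $\mathcal I_k^{(l)}$ and $\tilde r^{(l)}$ columns; $T_k^{(l)}$ is a real matrix with rows indexed by $\mathcal J_k^{(l)}$ and $\tilde r^{(l)}$ columns. Set $\tilde r^{(0)}=1$. Quantities built from an input $p$. $p_1^{(0)}=p$ (with a trivial extra index in $[1]$) and $p_k^{(l)}=p(\mathcal I_k^{(l)};\mathcal J_k^{(l)})T_k^{(l)}$ for $l\in[L]$, viewed as a matrix indexed by $\mathcal I_k^{(l)}\times[\tilde r^{(l)}]$ or, for $l<L$, as a three-index tensor on $\mathcal I_{2k-1}^{(l+1)}\times\mathcal I_{2k}^{(l+1)}\times[\tilde r^{(l)}]$. For $l\in[L]$, $k\in[2^l]$: $A_k^{(l)}=S_k^{(l)T}p_k^{(l)}=S_k^{(l)T}p(\mathcal I_k^{(l)};\mathcal J_k^{(l)})T_k^{(l)}$. For $l\in[L]$, $k\in[2^{l-1}]$, $\gamma\in[\tilde r^{(l-1)}]$: $B_k^{(l-1)}(:,:,\gamma)=S_{2k-1}^{(l)T}\,p_k^{(l-1)}(:,:,\gamma)\,S_{2k}^{(l)}$ and $G_k^{(l-1)}(:,:,\gamma)=\big(\mathcal P_{r^{(l)}}(A_{2k-1}^{(l)})\big)^\dagger B_k^{(l-1)}(:,:,\gamma)\big(\mathcal P_{r^{(l)}}(A_{2k}^{(l)})^T\big)^\dagger$. A superscript $*$ (as in $p_k^{(l)*},A_k^{(l)*},B_k^{(l)*},G_k^{(l)*}$)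 means the quantity is computed with $p=p^*$; a hat (as in $\hat A_k^{(l)},\hat B_k^{(l)},\hat G_k^{(l)}$) means it is computed with $p=\hat p$, where $\hat p(x)=\frac1N\#\{i:y^i=x\}$ is the empirical distribution. Estimator. $\tilde p_k^{(L)}=\hat p(\mathcal I_k^{(L)};\mathcal J_k^{(L)})T_k^{(L)}$ for $k\in[2^L]$, and for $l=L,\dots,1$, $k\in[2^{l-1}]$, slice by slice $\tilde p_k^{(l-1)}(:,:,\gamma)=\tilde p_{2k-1}^{(l)}\,\hat G_k^{(l-1)}(:,:,\gamma)\,\tilde p_{2k}^{(l)T}$ for $\gamma\in[\tilde r^{(l-1)}]$, with the first two indices then merged into one index in $\mathcal I_k^{(l-1)}$. The output of the algorithm applied to $\hat p$ is $\tilde p:=\tilde p_1^{(0)}$. *)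

(* Defs.v *)
From HB Require Import structures.
From mathcomp Require Export all_boot all_order all_algebra.
From mathcomp Require Export all_classical all_reals all_analysis.

Set Implicit Arguments.
Unset Strict Implicit.
Unset Printing Implicit Defensive.
Import Order.TTheory GRing.Theory Num.Theory.
Local Open Scope classical_set_scope.
Local Open Scope ring_scope.

Section MatrixNorms.
Context {R : realType}.

Definition frob m n (M : 'M[R]_(m, n)) : R :=
  Num.sqrt (\sum_i \sum_j M i j ^+ 2).

(* Operator norm for the Euclidean norms, [frob] being the Euclidean norm on
   column vectors. *)
Definition specnorm m n (M : 'M[R]_(m, n)) : R :=
  sup [set frob (M *m x) | x in [set x : 'cV[R]_n | frob x <= 1]].

Definition penrose m n (M : 'M[R]_(m, n)) (X : 'M[R]_(n, m)) : Prop :=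
  [/\ M *m X *m M = M, X *m M *m X = X,
      (M *m X)^T = M *m X & (X *m M)^T = X *m M].

(* Moore-Penrose pseudo-inverse (the library's [pinvmx] only satisfies some of
   these conditions); it exists and is unique, see [pinvP] and
   [penrose_uniq]. *)
Definition pinv m n (M : 'M[R]_(m, n)) : 'M[R]_(n, m) :=
  xget 0 [set X | penrose M X].

(* Such an X need not be unique for the spectral norm. *)
Definition best_rank_approx m n (r : nat) (M X : 'M[R]_(m, n)) : Prop :=
  (\rank X <= r)%N /\
  forall Y : 'M[R]_(m, n), (\rank Y <= r)%N ->
    specnorm (M - X) <= specnorm (M - Y).

(* [mxalgebra] compares row spaces, hence the transpositions. *)
Definition range_sub m n1 n2 (A : 'M[R]_(m, n1)) (B : 'M[R]_(m, n2)) : bool :=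
  (A^T <= B^T)%MS.

Definition range_eq m n1 n2 (A : 'M[R]_(m, n1)) (B : 'M[R]_(m, n2)) : bool :=
  (A^T == B^T)%MS.

Definition orthonormal_cols m n (A : 'M[R]_(m, n)) : Prop :=
  forall i j : 'I_n, \sum_a A a i * A a j = (i == j)%:R.

Lemma trmx_mul_self_eq0 m n (C : 'M[R]_(m, n)) : C^T *m C = 0 -> C = 0.
Proof.
move=> C0; apply/matrixP => i j; rewrite !mxE.
have /eqP := congr1 (fun M : 'M[R]_n => M j j) C0; rewrite !mxE psumr_eq0 => [/allP|a _].
  by move=> /(_ i); rewrite mem_index_enum mxE mulf_eq0 orbb => /(_ isT)/eqP.
by rewrite mxE -expr2 sqr_ge0.
Qed.

Lemma gram_unit m n (C : 'M[R]_(m, n)) : row_free C^T -> C^T *m C \in unitmx.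
Proof.
move=> Cfree; rewrite -row_free_unit -kermx_eq0; apply/eqP.
set K := kermx _.
have : K *m C^T *m (C *m K^T) = 0 by rewrite mulmxA -(mulmxA K) mulmx_ker mul0mx.
rewrite -[K *m C^T]trmxK trmx_mul !trmxK => /trmx_mul_self_eq0.
move=> /(congr1 trmx); rewrite trmx_mul trmxK trmx0 => /eqP.
by rewrite mulmx_free_eq0 // => /eqP.
Qed.

Lemma pinvP m n (M : 'M[R]_(m, n)) : penrose M (pinv M).
Proof.
apply: (@xgetPex _ 0 [set X | penrose M X]).
have [k [C [F [CF uC uF]]]] : exists k (C : 'M[R]_(m, k)) (F : 'M[R]_(k, n)),
    [/\ C *m F = M, C^T *m C \in unitmx & F *m F^T \in unitmx].
  exists (\rank M), (col_base M), (row_base M); split; first exact: mulmx_base.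
    by apply: gram_unit; rewrite /row_free mxrank_tr; exact: col_base_full.
  have := @gram_unit _ _ (row_base M)^T; rewrite trmxK; apply.
  exact: row_base_free.
set gC := invmx (C^T *m C); set gF := invmx (F *m F^T).
have gCs : gC^T = gC by rewrite /gC trmx_inv trmx_mul trmxK.
have gFs : gF^T = gF by rewrite /gF trmx_inv trmx_mul trmxK.
have gCl : gC *m C^T *m C = 1%:M by rewrite -mulmxA mulVmx.
have gFr : F *m F^T *m gF = 1%:M by rewrite mulmxV.
pose X := F^T *m gF *m (gC *m C^T).
have MX : M *m X = C *m (gC *m C^T).
  by rewrite -CF /X !mulmxA -(mulmxA C F) -(mulmxA C) gFr mulmx1.
have XM : X *m M = F^T *m gF *m F.
  by rewrite -CF /X mulmxA -(mulmxA (F^T *m gF)) gCl mulmx1.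
exists X; split.
- by rewrite MX -CF mulmxA -(mulmxA C) gCl mulmx1.
- by rewrite XM /X mulmxA -(mulmxA (F^T *m gF) F) (mulmxA F) gFr mulmx1.
- by rewrite MX !trmx_mul trmxK gCs mulmxA.
- by rewrite XM !trmx_mul trmxK gFs mulmxA.
Qed.

Lemma penrose_uniq m n (M : 'M[R]_(m, n)) X Y :
  penrose M X -> penrose M Y -> X = Y.
Proof.
move=> [X1 X2 X3 X4] [Y1 Y2 Y3 Y4].
have MXY : M *m X = M *m Y.
  rewrite -{1}Y1 -mulmxA -[in LHS]Y3 -[in LHS]X3 -trmx_mul.
  by rewrite mulmxA X1 Y3.
have XYM : X *m M = Y *m M.
  rewrite -{1}Y1 -mulmxA mulmxA -[in LHS]X4 -[in LHS]Y4 -trmx_mul.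
  by rewrite -mulmxA [M *m _]mulmxA X1 Y4.
by rewrite -X2 -mulmxA MXY mulmxA XYM.
Qed.

End MatrixNorms.

Section Indices.
Variables (L : nat) (n : 'I_(2 ^ L) -> nat).

Definition tidx := {dffun forall i : 'I_(2 ^ L), 'I_(n i)}.

Definition midx (C : {set 'I_(2 ^ L)}) :=
  {dffun forall i : {i : 'I_(2 ^ L) | i \in C}, 'I_(n (val i))}.

(* Indices start from 0: [cluster l k], for k < 2 ^ l, has the two children
   [cluster l.+1 k.*2] and [cluster l.+1 k.*2.+1]. *)
Definition cluster (l k : nat) : {set 'I_(2 ^ L)} :=
  [set i : 'I_(2 ^ L) | (k * 2 ^ (L - l) <= i < k.+1 * 2 ^ (L - l))%N]%SET.

Definition Iidx l k := midx (cluster l k).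
Definition Jidx l k := midx (~: cluster l k)%SET.

Fact in_setU_right (A B : {set 'I_(2 ^ L)}) i :
  i \in (A :|: B)%SET -> i \notin A -> i \in B.
Proof. by rewrite finset.in_setU => /orP[->|]. Qed.

Definition pick2 (A B : {set 'I_(2 ^ L)}) (a : midx A) (b : midx B) i
    (iAB : i \in (A :|: B)%SET) : 'I_(n i) :=
  match boolP (i \in A) with
  | AltTrue iA => a (exist _ i iA)
  | AltFalse iA => b (exist _ i (in_setU_right iAB iA))
  end.

Definition glue (A B C : {set 'I_(2 ^ L)}) (CAB : C \subset (A :|: B)%SET)
    (a : midx A) (b : midx B) : midx C :=
  [ffun i => pick2 a b (fintype.subsetP CAB _ (valP i))].

Definition restr (A C : {set 'I_(2 ^ L)}) (AC : A \subset C) (c : midx C) :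
    midx A :=
  [ffun i => c (exist _ (val i) (fintype.subsetP AC _ (valP i)))].

Fact in_setUC (C : {set 'I_(2 ^ L)}) i : i \in (C :|: ~: C)%SET.
Proof. by rewrite finset.setUCr finset.in_setT. Qed.

Definition join (C : {set 'I_(2 ^ L)}) (a : midx C) (b : midx (~: C)%SET) :
    tidx :=
  [ffun i => pick2 a b (in_setUC C i)].

Definition trestr (C : {set 'I_(2 ^ L)}) (x : tidx) : midx C :=
  [ffun i => x (val i)].

Fact cluster_children l k : (l < L)%N ->
  cluster l k = (cluster l.+1 k.*2 :|: cluster l.+1 k.*2.+1)%SET.
Proof.
move=> lL; apply/setP => i; rewrite !inE.
have -> : (L - l = (L - l.+1).+1)%N by rewrite -subSn.
set m := (2 ^ (L - l.+1))%N.
have -> : (k * 2 ^ (L - l.+1).+1 = k.*2 * m)%N by rewrite expnS mulnA muln2.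
have -> : (k.+1 * 2 ^ (L - l.+1).+1 = k.*2.+2 * m)%N.
  by rewrite expnS mulnA muln2.
apply/idP/idP => [/andP[h1 h2]|/orP[]/andP[h1 h2]].
- by rewrite h1 h2 andbT /=; case: ltnP.
- by rewrite h1 (leq_trans h2) // leq_mul2r leqnSn orbT.
- by rewrite h2 (leq_trans _ h1) // leq_mul2r leqnSn orbT.
Qed.

Fact cluster_cover l k : (l < L)%N ->
  cluster l k \subset (cluster l.+1 k.*2 :|: cluster l.+1 k.*2.+1)%SET.
Proof. by move=> /cluster_children ->. Qed.

Fact cluster_left l k : (l < L)%N -> cluster l.+1 k.*2 \subset cluster l k.
Proof. by move=> /cluster_children ->; exact: finset.subsetUl. Qed.

Fact cluster_right l k : (l < L)%N -> cluster l.+1 k.*2.+1 \subset cluster l k.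
Proof. by move=> /cluster_children ->; exact: finset.subsetUr. Qed.

End Indices.

Section Network.
Context {R : realType}.
Variables (L : nat) (n : 'I_(2 ^ L) -> nat).

Local Notation I l k := (Iidx n l k).
Local Notation J l k := (Jidx n l k).

Definition tnorm (p : tidx n -> R) : R := Num.sqrt (\sum_x p x ^+ 2).

Definition pmf (p : tidx n -> R) : Prop :=
  (forall x, 0 <= p x) /\ \sum_x p x = 1.

Definition empirical (N : nat) (y : 'I_N -> tidx n) (x : tidx n) : R :=
  #|[set i | y i == x]%SET|%:R / N%:R.

Definition unfold (p : tidx n -> R) l k : 'M[R]_(#|{: I l k}|, #|{: J l k}|) :=
  \matrix_(a, b) p (join (enum_val a) (enum_val b)).

(* Matrices with rows [I l k] and r columns, seen as three-index tensors: the
   slice at the last index g, and the inverse operation, which merges the first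
   two indices of the slices Z g. *)
Definition slice l k (lL : (l < L)%N) r (M : 'M[R]_(#|{: I l k}|, r))
    (g : 'I_r) : 'M[R]_(#|{: I l.+1 k.*2}|, #|{: I l.+1 k.*2.+1}|) :=
  \matrix_(a, b)
    M (enum_rank (glue (cluster_cover k lL) (enum_val a) (enum_val b))) g.

Definition merge l k (lL : (l < L)%N) r
    (Z : 'I_r -> 'M[R]_(#|{: I l.+1 k.*2}|, #|{: I l.+1 k.*2.+1}|)) :
    'M[R]_(#|{: I l k}|, r) :=
  \matrix_(c, g) Z g (enum_rank (restr (cluster_left k lL) (enum_val c)))
                     (enum_rank (restr (cluster_right k lL) (enum_val c))).

(* Rows: the first index; columns: all pairs (second index, slice index). *)
Definition unfold3 m1 m2 r (Z : 'I_r -> 'M[R]_(m1, m2)) :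
    'M[R]_(m1, #|{: 'I_m2 * 'I_r}|) :=
  \matrix_(a, e) Z (enum_val e).2 a (enum_val e).1.

Variables (rt : nat -> nat)
  (S : forall l k : nat, 'M[R]_(#|{: I l k}|, rt l))
  (T : forall l k : nat, 'M[R]_(#|{: J l k}|, rt l))
  (r : nat -> nat)
  (Pr : nat -> forall m1 m2 : nat, 'M[R]_(m1, m2) -> 'M[R]_(m1, m2)).

Section Quantities.
Variable p : tidx n -> R.

(* At l = 0, the column index set [J 0 0] is a singleton and rt 0 = 1, so that
   the product with the all-ones matrix is p with a trivial extra index. *)
Definition sketched l k : 'M[R]_(#|{: I l k}|, rt l) :=
  unfold p l k *m (if l == 0%N then const_mx 1 else T l k).

Definition Amx l k : 'M[R]_(rt l) := (S l k)^T *m sketched l k.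

Definition Bmx l k (lL : (l < L)%N) (g : 'I_(rt l)) : 'M[R]_(rt l.+1) :=
  (S l.+1 k.*2)^T *m slice lL (sketched l k) g *m S l.+1 k.*2.+1.

Definition PAmx l k : 'M[R]_(rt l) := Pr (r l) (Amx l k).

Definition Gmx l k (lL : (l < L)%N) (g : 'I_(rt l)) : 'M[R]_(rt l.+1) :=
  pinv (PAmx l.+1 k.*2) *m Bmx k lL g *m pinv (PAmx l.+1 k.*2.+1)^T.

Fact level_lt l j : (l + j.+1 = L)%N -> (l < L)%N.
Proof. by move=> <-; rewrite -addSnnS leq_addr. Qed.

Fact level_succ l j : (l + j.+1 = L)%N -> (l.+1 + j = L)%N.
Proof. by rewrite addSnnS. Qed.

(* The estimator at the level l lying j steps above the leaves. *)
Fixpoint estim_rec (j l : nat) {struct j} :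
    (l + j = L)%N -> forall k, 'M[R]_(#|{: I l k}|, rt l) :=
  match j return (l + j = L)%N -> forall k, 'M[R]_(#|{: I l k}|, rt l) with
  | 0%N => fun _ k => sketched l k
  | j'.+1 => fun e k =>
      let lL := level_lt e in
      let child := estim_rec (level_succ e) in
      merge lL (fun g => child k.*2 *m Gmx k lL g *m (child k.*2.+1)^T)
  end.

Definition estim_mx l (lL : (l <= L)%N) k : 'M[R]_(#|{: I l k}|, rt l) :=
  estim_rec (subnKC lL) k.

Definition estimator (rt0 : rt 0 = 1%N) (x : tidx n) : R :=
  estim_mx (leq0n L) 0 (enum_rank (trestr (cluster L 0 0) x))
    (cast_ord (esym rt0) ord0).

End Quantities.

End Network.

Section Sampling.
Local Open Scope ereal_scope.
Context {R : realType} (d : measure_display) (Om : measurableType d).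
Variables (P : probability Om R) (X : finType) (N : nat).

(* The finite type X carries the discrete sigma-algebra. *)
Definition iid (y : 'I_N -> Om -> X) (p : X -> R) : Prop :=
  [/\ forall i x, measurable (y i @^-1` [set x]),
      forall i x, P (y i @^-1` [set x]) = (p x)%:E
    & forall (K : {set 'I_N}) (B : 'I_N -> set X),
        P (\bigcap_(i in [set` K]) (y i @^-1` B i)) =
        (\prod_(i in K) fine (P (y i @^-1` B i)))%:E].

End Sampling.

(* Main.v *)
Require Import Defs.
From mathcomp Require Import ring lra.
Set Implicit Arguments.
Unset Strict Implicit.
Unset Printing Implicit Defensive.
Import Order.TTheory GRing.Theory Num.Theory.
Local Open Scope classical_set_scope.
Local Open Scope ring_scope.

(** Why the bound holds.

    Everything reduces to one number, the Frobenius distance [eta] between the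
    empirical distribution and [pstar]. The sketches have orthonormal columns,
    so each sketched quantity computed from the sample (the leaves [sketched],
    the matrices [Amx] and the slices of [Bmx]) is within [eta] of its
    exact value, at all the nodes simultaneously. The tree therefore needs no
    union bound, and the factor [2 * rmax * 2 ^ L * L] inside the logarithm only
    serves through its being at least 4.

    Concentration. The distance [eta] is [N^-1] times the Euclidean norm
    [count_deviation] of a sum of [N] independent centred vectors. Its mean is
    at most [1 / sqrt N], and replacing one sample moves it by at most
    [sqrt 2 / N]. The bounded difference method, an induction on the number of
    draws, gives an exponential tail ([count_deviation_tail]), and the constants
    are such that, with probability at least [1 - delta], [eta <= 4 / 9 * eps]
    where [eps = 3 * sqrt rmax * ln (...) / sqrt N].

    Stability of the cores. On [pstar] the contraction of the tree is the
    identity ([slice_recover]). A best rank-[r] approximation of the sampled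
    [Amx] is within [2 * eta] of the exact one in spectral norm, because the
    exact matrix competes in the minimisation. Pseudo-inverses are not
    continuous, and a best approximation of rank at most [r] may have a smaller
    rank, so that Wedin's perturbation bound for matrices of equal rank does not
    apply. But the differences of pseudo-inverses only act on the exact
    slices of [Bmx], whose columns and rows lie in the ranges of the exact
    [Amx]; there, as long as [eta * cA <= 4 / 9], [pinv_perturbation] bounds
    them by a multiple of [eta * cA * cAh].

    Propagation. Telescoping one contraction shows that the error of a node is
    at most [rho] times that of its children plus [cpt ^+ 2] times the error of
    the core; summing the geometric series over the [L] levels gives the
    stated bound ([estim_rec_error], [estimator_error]). If
    [eta * cA > 4 / 9], then [1 <= eps * cA] and the right-hand side exceeds the
    sum of the norms of the estimator and of [pstar]. *)

(** * Euclidean norms of finite families *)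

Section EuclideanNorm.
Context {R : realType}.

Definition l2 (I : finType) (f : I -> R) : R := Num.sqrt (\sum_i f i ^+ 2).

Lemma sum_sqr_ge0 (I : finType) (f : I -> R) : 0 <= \sum_i f i ^+ 2.
Proof. by apply: sumr_ge0 => i _; exact: sqr_ge0. Qed.

Lemma l2_ge0 (I : finType) (f : I -> R) : 0 <= l2 f.
Proof. exact: sqrtr_ge0. Qed.

Lemma sqr_l2 (I : finType) (f : I -> R) : l2 f ^+ 2 = \sum_i f i ^+ 2.
Proof. by rewrite sqr_sqrtr // sum_sqr_ge0. Qed.

Lemma le_of_sqr (x y : R) : 0 <= y -> x ^+ 2 <= y ^+ 2 -> x <= y.
Proof.
move=> y0 xy; have [x0|/ltW x0] := leP 0 x; last exact: le_trans y0.
by rewrite -(@ler_pXn2r _ 2) ?nnegrE.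
Qed.

(** Lagrange's identity: the difference of the two sides is half the sum of the
    squares of the minors [f i * g j - f j * g i]. *)
Lemma l2_CauchySchwarz (I : finType) (f g : I -> R) :
  \sum_i f i * g i <= l2 f * l2 g.
Proof.
apply: le_of_sqr; first by rewrite mulr_ge0 ?l2_ge0.
rewrite exprMn !sqr_l2.
have := @sumr_ge0 _ _ (index_enum I) xpredT
  (fun i => \sum_j (f i * g j - f j * g i) ^+ 2).
move=> /(_ (fun i _ => sumr_ge0 _ (fun j _ => sqr_ge0 _))).
have -> : \sum_i \sum_j (f i * g j - f j * g i) ^+ 2 =
    2 * ((\sum_i f i ^+ 2) * (\sum_i g i ^+ 2) - (\sum_i f i * g i) ^+ 2).
  rewrite [(\sum_i f i * g i) ^+ 2]expr2 mulrBr mulr2n mulrDl mul1r.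
  rewrite [X in _ = X + _ - _]big_distrlr [X in _ = _ + X - _]big_distrlr.
  rewrite [in X in _ = _ + X - _]exchange_big big_distrlr mulr_sumr /=.
  rewrite -big_split -sumrB; apply: eq_bigr => i _.
  rewrite mulr_sumr -big_split -sumrB; apply: eq_bigr => j _ /=.
  ring.
by rewrite pmulr_rge0 // subr_ge0.
Qed.

Lemma l2D (I : finType) (f g : I -> R) : l2 (fun i => f i + g i) <= l2 f + l2 g.
Proof.
apply: le_of_sqr; first by rewrite addr_ge0 ?l2_ge0.
rewrite sqrrD !sqr_l2.
have -> : \sum_i (f i + g i) ^+ 2 =
    \sum_i f i ^+ 2 + (\sum_i f i * g i) *+ 2 + \sum_i g i ^+ 2.
  by rewrite -sumrMnl -!big_split; apply: eq_bigr => i _; rewrite sqrrD.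
by rewrite lerD2r lerD2l lerMn2r l2_CauchySchwarz orbT.
Qed.

Lemma ler_l2 (I : finType) (f g : I -> R) :
  (forall i, `|f i| <= g i) -> l2 f <= l2 g.
Proof.
move=> fg; rewrite ler_sqrt ?sum_sqr_ge0 //; apply: ler_sum => i _.
rewrite -real_normK ?num_real // ler_pXn2r ?nnegrE //.
exact: le_trans (fg i).
Qed.

Lemma l2Z (I : finType) (c : R) (f : I -> R) :
  0 <= c -> l2 (fun i => c * f i) = c * l2 f.
Proof.
move=> c0; rewrite /l2; under eq_bigr do rewrite exprMn.
by rewrite -mulr_sumr sqrtrM ?sqr_ge0 // sqrtr_sqr ger0_norm.
Qed.

Lemma l2N (I : finType) (f : I -> R) : l2 (fun i => - f i) = l2 f.
Proof. by rewrite /l2; under eq_bigr do rewrite sqrrN. Qed.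

Lemma eq_l2 (I : finType) (f g : I -> R) : f =1 g -> l2 f = l2 g.
Proof. by move=> fg; rewrite /l2; under eq_bigr do rewrite fg. Qed.

Lemma l2_dist (I : finType) (f g : I -> R) :
  `|l2 f - l2 g| <= l2 (fun i => f i - g i).
Proof.
have h (u v : I -> R) : l2 u - l2 v <= l2 (fun i => u i - v i).
  rewrite lerBlDr -(@eq_l2 _ (fun i => (u i - v i) + v i)) ?l2D // => i.
  by rewrite subrK.
rewrite ler_norml h andbT lerNl opprB (le_trans (h _ _)) //.
by rewrite -l2N (eq_l2 (g := fun i => f i - g i)) // => i; rewrite opprB.
Qed.

End EuclideanNorm.

(** * Frobenius and spectral norms *)

Section MatrixNormTheory.
Context {R : realType}.

Lemma frobE m n (M : 'M[R]_(m, n)) : frob M = l2 (fun e => M e.1 e.2).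
Proof. by rewrite /frob /l2 pair_bigA. Qed.

Lemma frob_ge0 m n (M : 'M[R]_(m, n)) : 0 <= frob M.
Proof. exact: sqrtr_ge0. Qed.

Lemma sqr_frob m n (M : 'M[R]_(m, n)) : frob M ^+ 2 = \sum_i \sum_j M i j ^+ 2.
Proof. by rewrite frobE sqr_l2 pair_bigA. Qed.

Lemma sqr_frob_trace m n (M : 'M[R]_(m, n)) : frob M ^+ 2 = \tr (M^T *m M).
Proof.
rewrite sqr_frob exchange_big; apply: eq_bigr => j _; rewrite mxE.
by apply: eq_bigr => i _; rewrite mxE expr2.
Qed.

Lemma frobD m n (M N : 'M[R]_(m, n)) : frob (M + N) <= frob M + frob N.
Proof.
rewrite !frobE; apply: le_trans (l2D _ _).
by rewrite /l2; under eq_bigr do rewrite mxE.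
Qed.

Lemma frobN m n (M : 'M[R]_(m, n)) : frob (- M) = frob M.
Proof. by rewrite !frobE -l2N; apply: eq_l2 => e; rewrite mxE opprK. Qed.

Lemma frobZ m n (c : R) (M : 'M[R]_(m, n)) : 0 <= c -> frob (c *: M) = c * frob M.
Proof. by move=> c0; rewrite !frobE -l2Z //; apply: eq_l2 => e; rewrite mxE. Qed.

Lemma frob0 m n : frob (0 : 'M[R]_(m, n)) = 0.
Proof. by rewrite -(scale0r (0 : 'M[R]_(m, n))) frobZ // mul0r. Qed.

Lemma frob_eq0 m n (M : 'M[R]_(m, n)) : frob M = 0 -> M = 0.
Proof.
move=> M0; apply: trmx_mul_self_eq0; apply/matrixP => i j.
have /eqP : frob M ^+ 2 = 0 by rewrite M0 expr0n.
rewrite sqr_frob pair_bigA psumr_eq0 => [/allP h|e _]; last exact: sqr_ge0.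
rewrite !mxE big1 // => k _; rewrite mxE.
have := h (k, i); rewrite mem_index_enum => /(_ isT) /=.
by rewrite sqrf_eq0 => /eqP ->; rewrite mul0r.
Qed.

Lemma frobB m n (M N : 'M[R]_(m, n)) : frob (M - N) <= frob M + frob N.
Proof. by rewrite -[frob N]frobN frobD. Qed.

Lemma frob_tr m n (M : 'M[R]_(m, n)) : frob M^T = frob M.
Proof.
congr Num.sqrt; rewrite exchange_big; apply: eq_bigr => j _.
by apply: eq_bigr => i _; rewrite mxE.
Qed.

Lemma trace_le_frob m n (M N : 'M[R]_(m, n)) :
  \tr (M^T *m N) <= frob M * frob N.
Proof.
rewrite !frobE; apply: le_trans (l2_CauchySchwarz _ _).
rewrite -(pair_bigA _ (fun i j => M i j * N i j)) /= exchange_big /=.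
apply: ler_sum => j _; rewrite mxE.
by apply: ler_sum => i _; rewrite mxE.
Qed.

Lemma sqr_frob_col m n (M : 'M[R]_(m, n)) :
  frob M ^+ 2 = \sum_j frob (col j M) ^+ 2.
Proof.
rewrite sqr_frob exchange_big; apply: eq_bigr => j _; rewrite sqr_frob.
by apply: eq_bigr => i _; rewrite big_ord1 mxE.
Qed.

(** The squared Frobenius norm is additive over the columns. *)
Lemma frob_mulmx_cols m n (M : 'M[R]_(m, n)) (c : R) : 0 <= c ->
  (forall x : 'cV[R]_n, frob (M *m x) <= c * frob x) ->
  forall q (X : 'M[R]_(n, q)), frob (M *m X) <= c * frob X.
Proof.
move=> c0 Mc q X; apply: le_of_sqr; first by rewrite mulr_ge0 ?frob_ge0.
rewrite exprMn !sqr_frob_col mulr_sumr; apply: ler_sum => j _.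
have -> : col j (M *m X) = M *m col j X.
  by apply/matrixP => i k; rewrite !mxE; apply: eq_bigr => e _; rewrite mxE.
by rewrite -exprMn ler_pXn2r ?nnegrE ?mulr_ge0 ?frob_ge0.
Qed.

(** Cauchy-Schwarz: [frob (M^T *m X) ^+ 2] is the inner product of [X] and
    [M *m (M^T *m X)]. This one argument transposes operator bounds and shows
    that projectors and orthonormal sketches are contractions. *)
Lemma frob_mulmx_adjoint m n (M : 'M[R]_(m, n)) (c : R) q (X : 'M[R]_(m, q)) :
    0 <= c ->
    frob (M *m (M^T *m X)) <= c * frob (M^T *m X) ->
  frob (M^T *m X) <= c * frob X.
Proof.
move=> c0 Mc; have [->|X0] := eqVneq (frob (M^T *m X)) 0.
  by rewrite mulr_ge0 ?frob_ge0.
have {}X0 : 0 < frob (M^T *m X) by rewrite lt_def X0 frob_ge0.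
rewrite -(ler_pM2r X0) -expr2 sqr_frob_trace trmx_mul trmxK -mulmxA.
apply: le_trans (trace_le_frob _ _) _.
by rewrite mulrAC mulrC ler_wpM2r ?frob_ge0.
Qed.

Lemma frob_mulmx_vec m n (M : 'M[R]_(m, n)) (x : 'cV[R]_n) :
  frob (M *m x) <= frob M * frob x.
Proof.
apply: le_of_sqr; first by rewrite mulr_ge0 ?frob_ge0.
rewrite exprMn !sqr_frob mulr_suml; apply: ler_sum => i _.
rewrite big_ord1 mxE.
have sq2 : \sum_(j < n) x j 0 ^+ 2 = l2 (fun j => x j 0) ^+ 2 by rewrite sqr_l2.
under [X in _ <= _ * X]eq_bigr do rewrite big_ord1.
rewrite sq2 -sqr_l2 -exprMn -[leLHS]real_normK ?num_real //.
rewrite ler_pXn2r ?nnegrE ?mulr_ge0 ?l2_ge0 //.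
rewrite ler_norml l2_CauchySchwarz andbT lerNl -l2N -sumrN.
apply: le_trans (l2_CauchySchwarz _ _).
by apply: ler_sum => j _; rewrite mulNr.
Qed.

Lemma specnorm_has_sup m n (M : 'M[R]_(m, n)) :
  has_sup [set frob (M *m x) | x in [set x : 'cV[R]_n | frob x <= 1]].
Proof.
split; first by exists (frob (M *m (0 : 'cV_n))); exists 0; rewrite //= frob0.
exists (frob M) => _ [x /= x1 <-]; apply: le_trans (frob_mulmx_vec _ _) _.
by rewrite ler_piMr ?frob_ge0.
Qed.

Lemma specnorm_ge0 m n (M : 'M[R]_(m, n)) : 0 <= specnorm M.
Proof.
apply: ub_le_sup; first exact: (specnorm_has_sup M).2.
by exists 0; rewrite /= ?frob0 // mulmx0 frob0.
Qed.

Lemma frob_mulmxl m n (M : 'M[R]_(m, n)) q (X : 'M[R]_(n, q)) :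
  frob (M *m X) <= specnorm M * frob X.
Proof.
apply: frob_mulmx_cols; first exact: specnorm_ge0.
move=> x; have [x0|x0] := eqVneq (frob x) 0.
  by rewrite x0 (frob_eq0 x0) mulmx0 frob0 mulr0.
have {}x0 : 0 < frob x by rewrite lt_def x0 frob_ge0.
rewrite -ler_pdivrMr // mulrC -frobZ ?invr_ge0 ?frob_ge0 // scalemxAr.
apply: ub_le_sup; first exact: (specnorm_has_sup M).2.
exists ((frob x)^-1 *: x) => //=.
by rewrite frobZ ?invr_ge0 ?frob_ge0 // mulVf ?gt_eqF.
Qed.

Lemma specnorm_le m n (M : 'M[R]_(m, n)) c : 0 <= c ->
  (forall x : 'cV[R]_n, frob (M *m x) <= c * frob x) -> specnorm M <= c.
Proof.
move=> c0 Mc; apply: ge_sup; first exact: (specnorm_has_sup M).1.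
move=> _ [x /= x1 <-]; apply: le_trans (Mc x) _.
by rewrite ler_piMr.
Qed.

Lemma specnorm_le_frob m n (M : 'M[R]_(m, n)) : specnorm M <= frob M.
Proof.
by apply: specnorm_le; [exact: frob_ge0|exact: frob_mulmx_vec].
Qed.

Lemma specnormD m n (M N : 'M[R]_(m, n)) :
  specnorm (M + N) <= specnorm M + specnorm N.
Proof.
apply: specnorm_le => [|x]; first by rewrite addr_ge0 ?specnorm_ge0.
by rewrite mulmxDl mulrDl (le_trans (frobD _ _)) // lerD ?frob_mulmxl.
Qed.

Lemma specnormN m n (M : 'M[R]_(m, n)) : specnorm (- M) = specnorm M.
Proof.
by congr sup; apply/seteqP; split => _ [x /= x1 <-]; exists x => //;
  rewrite mulNmx frobN.
Qed.

Lemma frob_mulmx_tr m n (M : 'M[R]_(m, n)) q (X : 'M[R]_(m, q)) :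
  frob (M^T *m X) <= specnorm M * frob X.
Proof. by apply: frob_mulmx_adjoint; rewrite ?specnorm_ge0 ?frob_mulmxl. Qed.

Lemma frob_mulmxr m n q (M : 'M[R]_(m, n)) (X : 'M[R]_(q, n)) :
  frob (X *m M^T) <= specnorm M * frob X.
Proof. by rewrite -frob_tr trmx_mul trmxK -[frob X]frob_tr frob_mulmxl. Qed.

Lemma orthonormal_gram m n (S : 'M[R]_(m, n)) :
  orthonormal_cols S -> S^T *m S = 1%:M.
Proof.
move=> oS; apply/matrixP => i j; rewrite !mxE -oS.
by apply: eq_bigr => a _; rewrite mxE.
Qed.

Lemma frob_orthonormal_tr m n q (S : 'M[R]_(m, n)) (X : 'M[R]_(m, q)) :
  orthonormal_cols S -> frob (S^T *m X) <= frob X.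
Proof.
move=> oS; rewrite -[leRHS]mul1r; apply: frob_mulmx_adjoint => //.
rewrite mul1r; apply: le_of_sqr; first exact: frob_ge0.
rewrite [leLHS]sqr_frob_trace trmx_mul -mulmxA (mulmxA S^T) orthonormal_gram //.
by rewrite mul1mx -sqr_frob_trace.
Qed.

Lemma frob_orthonormalr m n q (S : 'M[R]_(m, n)) (X : 'M[R]_(q, m)) :
  orthonormal_cols S -> frob (X *m S) <= frob X.
Proof.
by move=> oS; rewrite -frob_tr trmx_mul -[leRHS]frob_tr frob_orthonormal_tr.
Qed.

Section Projector.
Variables (m : nat) (P : 'M[R]_m).
Hypotheses (P_sym : P^T = P) (P_idem : P *m P = P).

Lemma frob_coprojector q (X : 'M[R]_(m, q)) : frob (X - P *m X) <= frob X.
Proof.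
have -> : X - P *m X = (1%:M - P) *m X by rewrite mulmxBl mul1mx.
have QT : (1%:M - P)^T = 1%:M - P by rewrite linearB /= trmx1 P_sym.
rewrite -[leRHS]mul1r -{1}QT; apply: frob_mulmx_adjoint => //.
by rewrite mul1r QT mulmxA mulmxBl mul1mx mulmxBr mulmx1 P_idem subrr subr0.
Qed.

Lemma frob_pythagoras q (X : 'M[R]_(m, q)) :
  frob X ^+ 2 = frob (P *m X) ^+ 2 + frob (X - P *m X) ^+ 2.
Proof.
rewrite !sqr_frob_trace -linearD /=; congr (\tr _).
have -> : (X - P *m X)^T = X^T - X^T *m P by rewrite linearB /= trmx_mul P_sym.
rewrite trmx_mul P_sym mulmxBr !mulmxBl !mulmxA -(mulmxA X^T P P) P_idem.
by rewrite subrr subr0 addrC subrK.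
Qed.

End Projector.

End MatrixNormTheory.

(** * Perturbation of the pseudo-inverse *)

Section PseudoInverse.
Context {R : realType}.

Lemma pinv_tr m n (M : 'M[R]_(m, n)) : pinv M^T = (pinv M)^T.
Proof.
apply: penrose_uniq (pinvP _) _; have [h1 h2 h3 h4] := pinvP M.
by split; rewrite -?trmx_mul ?trmxK ?mulmxA ?h1 ?h2 ?h3 ?h4.
Qed.

(** Let [Z := pinv A *m M], whose columns lie in the row space of [A], and let
    [P := pinv B *m B] be the projector onto the row space of [B]. Since
    [P *m B^T = B^T], the part of [Z] outside the row space of [B] only comes
    from [A - B], and its norm is at most [e * a] times that of [Z]. The part
    inside equals [pinv B *m (M + (B - A) *m Z)]. By Pythagoras and
    [e * a <= 8 / 9], the norm of [Z] is then at most [9 / 2 * b] times that of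
    [M], whereas its definition only gives [a]; this exchange of [a] for [b] is
    what makes the final bound proportional to [a * b] instead of [a ^+ 2]. *)
Lemma pinv_perturbation m n q (A B : 'M[R]_(m, n)) (M : 'M[R]_(m, q)) a b e :
    specnorm (pinv A) <= a -> specnorm (pinv B) <= b -> specnorm (B - A) <= e ->
    e * a <= 8 / 9 -> A *m pinv A *m M = M ->
  frob ((pinv B - pinv A) *m M) <= 11 / 2 * (e * a * b) * frob M.
Proof.
move=> Aa Bb BAe ea AM.
have a0 := le_trans (specnorm_ge0 _) Aa.
have b0 := le_trans (specnorm_ge0 _) Bb.
have e0 := le_trans (specnorm_ge0 _) BAe.
have [_ A2 _ A4] := pinvP A; have [B1 B2 _ B4] := pinvP B.
set Z := pinv A *m M; set P := pinv B *m B.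
have PP : P *m P = P by rewrite /P mulmxA B2.
have AZ : A *m Z = M by rewrite /Z mulmxA.
have Za : frob Z <= a * frob M.
  by apply: le_trans (frob_mulmxl _ _) _; rewrite ler_wpM2r ?frob_ge0.
have EZ : frob ((B - A) *m Z) <= e * frob Z.
  by apply: le_trans (frob_mulmxl _ _) _; rewrite ler_wpM2r ?frob_ge0.
have PZ : frob (Z - P *m Z) <= e * a * frob Z.
  have ZW : Z = A^T *m ((pinv A)^T *m Z).
    by rewrite mulmxA -trmx_mul A4 /Z mulmxA A2.
  have PB : P *m B^T = B^T.
    by rewrite -[P]B4 -trmx_mul mulmxA B1.
  have -> : Z - P *m Z = (A - B)^T *m ((pinv A)^T *m Z)
                       - P *m ((A - B)^T *m ((pinv A)^T *m Z)).
    have -> : (A - B)^T = A^T - B^T by rewrite linearB.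
    rewrite {1 2}ZW (mulmxBl A^T) mulmxBr (mulmxA P B^T) PB.
    by rewrite opprB addrA subrK.
  apply: le_trans (frob_coprojector B4 PP _) _.
  apply: le_trans (frob_mulmx_tr _ _) _.
  rewrite -mulrA ler_pM ?specnorm_ge0 ?frob_ge0 //.
    by rewrite -specnormN opprB.
  by apply: le_trans (frob_mulmx_tr _ _) _; rewrite ler_wpM2r ?frob_ge0.
have PZb : frob (P *m Z) <= b * ((1 + e * a) * frob M).
  have -> : P *m Z = pinv B *m (M + (B - A) *m Z).
    by rewrite mulmxBl AZ addrC subrK (mulmxA (pinv B) B).
  apply: le_trans (frob_mulmxl _ _) _.
  rewrite ler_pM ?specnorm_ge0 ?frob_ge0 //.
  apply: le_trans (frobD _ _) _; rewrite mulrDl mul1r lerD2l.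
  by rewrite (le_trans EZ) // -mulrA ler_wpM2l.
have Zb : frob Z <= 9 / 2 * (b * frob M).
  have ea0 : 0 <= e * a by rewrite mulr_ge0.
  have bm0 : 0 <= b * frob M by rewrite mulr_ge0 ?frob_ge0.
  have z0 := frob_ge0 Z.
  apply: le_of_sqr; first by rewrite mulr_ge0.
  have := frob_pythagoras B4 PP Z.
  have : frob (P *m Z) ^+ 2 <= (b * ((1 + e * a) * frob M)) ^+ 2.
    by rewrite ler_pXn2r // nnegrE ?(le_trans _ PZb) ?frob_ge0.
  have : frob (Z - P *m Z) ^+ 2 <= (e * a * frob Z) ^+ 2.
    by rewrite ler_pXn2r // nnegrE ?(le_trans _ PZ) ?frob_ge0.
  set u := frob (P *m Z) ^+ 2; set v := frob (Z - P *m Z) ^+ 2.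
  move=> hv hu hz.
  set t := e * a in ea ea0 hv hu *; set z := frob Z in z0 hv hz *.
  set y := b * frob M in bm0 hu *.
  have {}hu : u <= ((1 + t) * y) ^+ 2 by rewrite /y mulrCA.
  have h1 : z ^+ 2 * (1 - t) <= y ^+ 2 * (1 + t).
    have t1 : 0 < 1 + t by lra.
    rewrite -(ler_pM2r t1).
    have -> : z ^+ 2 * (1 - t) * (1 + t) = z ^+ 2 - (t * z) ^+ 2 by ring.
    have -> : y ^+ 2 * (1 + t) * (1 + t) = ((1 + t) * y) ^+ 2 by ring.
    lra.
  have y2 := sqr_ge0 y; have z2 := sqr_ge0 z.
  (* (1 + t) / (1 - t) <= 17 <= (9 / 2) ^+ 2 when t <= 8 / 9 *)
  have h2 : z ^+ 2 * (1 / 9) <= z ^+ 2 * (1 - t) by rewrite ler_wpM2l //; lra.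
  have h3 : y ^+ 2 * (1 + t) <= y ^+ 2 * (17 / 9) by rewrite ler_wpM2l //; lra.
  rewrite exprMn; lra.
have -> : (pinv B - pinv A) *m M = - (pinv B *m ((B - A) *m Z)) - (Z - P *m Z).
  rewrite mulmxBl -/Z [(B - A) *m Z]mulmxBl AZ mulmxBr (mulmxA _ B) -/P.
  by rewrite opprB opprB addrA subrK.
apply: le_trans (frobB _ _) _; rewrite frobN.
have h1 : frob (pinv B *m ((B - A) *m Z)) <= b * (e * (a * frob M)).
  apply: le_trans (frob_mulmxl _ _) _.
  rewrite ler_pM ?specnorm_ge0 ?frob_ge0 //.
  by rewrite (le_trans EZ) // ler_wpM2l.
have h2 : frob (Z - P *m Z) <= e * a * (9 / 2 * (b * frob M)).
  by rewrite (le_trans PZ) // ler_wpM2l // mulr_ge0.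
lra.
Qed.

(** [A] competes in the minimisation, so [X] is at least as close to [M] as
    [A] is. *)
Lemma best_rank_approx_dist m n r (M A X : 'M[R]_(m, n)) :
  best_rank_approx r M X -> (\rank A <= r)%N ->
  specnorm (X - A) <= 2 * specnorm (M - A).
Proof.
move=> [_ best] /best MX; rewrite mulr2n mulrDl mul1r.
have -> : X - A = - (M - X) + (M - A) by rewrite opprB addrA subrK.
by apply: le_trans (specnormD _ _) _; rewrite specnormN lerD2r.
Qed.

Lemma range_subP m n1 n2 (A : 'M[R]_(m, n1)) (B : 'M[R]_(m, n2)) :
  range_sub A B -> exists W, A = B *m W.
Proof.
by move=> /submxP[D AD]; exists D^T; rewrite -[A]trmxK AD trmx_mul trmxK.
Qed.

End PseudoInverse.

(** * Concentration of the empirical distribution *)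

Section ExponentialBounds.
Context {R : realType}.

(** With [y = x / 8], [1 - y <= expR (- y)] gives
    [(1 - y) ^+ 8 <= expR (- x)], and what remains is a polynomial inequality
    in one variable. The range of [x] is what the choice of the Chernoff
    parameter below requires when there is a single sample. *)
Lemma expR_le_quadratic (x : R) : x <= 16 / 15 -> expR x <= 1 + x + x ^+ 2.
Proof.
move=> x_le; pose y := x / 8.
have y_le : y <= 2 / 15 by rewrite /y; lra.
have xE : x = 8 * y by rewrite /y; field.
have q0 : 0 <= 1 + x + x ^+ 2 by have := sqr_ge0 (x + 1 / 2); lra.
have hy : (1 - y) ^+ 8 <= expR (- x).
  have -> : - x = 8%:R * - y by rewrite xE mulrN.
  rewrite expRM_natl ler_pXn2r ?nnegrE ?expR_ge0 ?expR_ge1Dx //.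
  lra.
suff h : 1 <= (1 - y) ^+ 8 * (1 + x + x ^+ 2).
  have : 1 <= expR (- x) * (1 + x + x ^+ 2) by apply: le_trans h _; rewrite ler_wpM2r.
  by rewrite expRN mulrC ler_pdivlMr ?expR_gt0 // mul1r.
rewrite xE -subr_ge0.
have -> : (1 - y) ^+ 8 * (1 + 8 * y + (8 * y) ^+ 2) - 1 =
    y ^+ 2 * (28 - 344 * y + 1414 * y ^+ 2 - 3080 * y ^+ 3 + 4060 * y ^+ 4
      - 3368 * y ^+ 5 + 1729 * y ^+ 6 - 504 * y ^+ 7 + 64 * y ^+ 8) by ring.
apply: mulr_ge0; first exact: sqr_ge0.
have e2 := sqr_ge0 y.
have e4 : 0 <= y ^+ 4 by rewrite -[4%N]/(2 * 2)%N exprM sqr_ge0.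
have e6 : 0 <= y ^+ 6 by rewrite -[6%N]/(3 * 2)%N exprM sqr_ge0.
have e8 : 0 <= y ^+ 8 by rewrite -[8%N]/(4 * 2)%N exprM sqr_ge0.
have [y0|/ltW y0] := leP 0 y; last first.
  have o n : 0 <= (- y) ^+ n by rewrite exprn_ge0 // oppr_ge0.
  have o3 := o 3%N; have o5 := o 5%N; have o7 := o 7%N.
  have s3 : (- y) ^+ 3 = - y ^+ 3 by ring.
  have s5 : (- y) ^+ 5 = - y ^+ 5 by ring.
  have s7 : (- y) ^+ 7 = - y ^+ 7 by ring.
  rewrite s3 in o3; rewrite s5 in o5; rewrite s7 in o7.
  lra.
have h4 : 0 <= y ^+ 4 * (2060 - 3368 * y) by apply: mulr_ge0; [exact: e4|lra].
have h6 : 0 <= y ^+ 6 * (1729 - 504 * y) by apply: mulr_ge0; [exact: e6|lra].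
(* the remaining quartic has positive coefficients in [2 / 15 - y] *)
pose z := 2 / 15 - y; have z0 : 0 <= z by rewrite /z; lra.
have z2 : 0 <= z ^+ 2 by rewrite exprn_ge0.
have z3 : 0 <= z ^+ 3 by rewrite exprn_ge0.
have z4 : 0 <= z ^+ 4 by rewrite exprn_ge0.
have h : 0 <= 28 - 344 * y + 1414 * y ^+ 2 - 3080 * y ^+ 3 + 2000 * y ^+ 4.
  have -> : y = 2 / 15 - z by rewrite /z; ring.
  lra.
lra.
Qed.

Lemma expR_21_16_le4 : expR (21 / 16) <= 4 :> R.
Proof.
have sq (x a b : R) : 0 <= a -> a <= x -> b <= a * a -> b <= x ^+ 2.
  by move=> a0 ax ba; apply: le_trans ba _; rewrite expr2 ler_pM.
pose w : R := expR (- (21 / 256)).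
have w1 : 9179 / 10000 <= w by apply: le_trans (expR_ge1Dx _); lra.
have w2 : 8425 / 10000 <= w ^+ 2 by apply: (sq _ _ _ _ w1); clear; lra.
have w4 : 7098 / 10000 <= (w ^+ 2) ^+ 2 by apply: (sq _ _ _ _ w2); clear; lra.
have w8 : 5038 / 10000 <= ((w ^+ 2) ^+ 2) ^+ 2
  by apply: (sq _ _ _ _ w4); clear; lra.
have : 1 / 4 <= (((w ^+ 2) ^+ 2) ^+ 2) ^+ 2
  by apply: (sq _ _ _ _ w8); clear; lra.
have -> : (((w ^+ 2) ^+ 2) ^+ 2) ^+ 2 = expR (- (21 / 16)).
  by rewrite -!expRM_natl; congr expR; field.
by rewrite expRN mul1r lef_pV2 ?posrE ?expR_gt0.
Qed.

End ExponentialBounds.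

Section ProductExpectation.
Context {R : realType} (X : finType) (p : X -> R).
Hypotheses (p_ge0 : forall x, 0 <= p x) (p_sum1 : \sum_x p x = 1).

(** Expectation of a function of [N] independent draws from [p]. *)
Definition expect N (g : seq X -> R) : R :=
  \sum_(t : N.-tuple X) (\prod_(x <- t) p x) * g t.

Lemma expect0 g : expect 0 g = g [::].
Proof.
rewrite /expect (bigD1 [tuple]) //= big_nil mul1r big1 ?addr0 // => t.
by rewrite (tuple0 t) => /eqP.
Qed.

Lemma expectS N g : expect N.+1 g = \sum_x p x * expect N (fun s => g (x :: s)).
Proof.
rewrite /expect; under [RHS]eq_bigr do rewrite mulr_sumr.
rewrite pair_bigA /=.
pose f (e : X * N.-tuple X) := [tuple of e.1 :: e.2].
pose f' (t : N.+1.-tuple X) := (thead t, [tuple of behead t]).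
have ff' : cancel f f'.
  by move=> [x t]; rewrite /f /f' theadE; congr pair; apply: val_inj.
have f'f : cancel f' f by move=> t; rewrite /f /f' /= -tuple_eta.
rewrite (reindex f) /=; last by apply: onW_bij; exists f'.
by apply: eq_bigr => e _; rewrite big_cons mulrA.
Qed.

Lemma eq_expect N g h : g =1 h -> expect N g = expect N h.
Proof. by move=> gh; apply: eq_bigr => t _; rewrite gh. Qed.

Lemma ler_expect N g h : (forall s, g s <= h s) -> expect N g <= expect N h.
Proof.
move=> gh; apply: ler_sum => t _; rewrite ler_wpM2l //.
by apply: prodr_ge0 => x _.
Qed.

Lemma expectD N g h : expect N (fun s => g s + h s) = expect N g + expect N h.
Proof. by rewrite -big_split; apply: eq_bigr => t _; rewrite mulrDr. Qed.

Lemma expectZ N c g : expect N (fun s => c * g s) = c * expect N g.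
Proof. by rewrite mulr_sumr; apply: eq_bigr => t _; rewrite mulrCA. Qed.

Lemma expect_cst N c : expect N (fun=> c) = c.
Proof.
elim: N => [|N IH]; first by rewrite expect0.
by rewrite expectS; under eq_bigr do rewrite IH; rewrite -mulr_suml p_sum1 mul1r.
Qed.

Lemma expect_sum N (I : finType) (g : I -> seq X -> R) :
  expect N (fun s => \sum_i g i s) = \sum_i expect N (g i).
Proof.
rewrite exchange_big; apply: eq_bigr => t _; by rewrite mulr_sumr.
Qed.

(** Nonnegativity of the variance. *)
Lemma sqr_expect_le N g : expect N g ^+ 2 <= expect N (fun s => g s ^+ 2).
Proof.
set m := expect N g.
have : 0 <= expect N (fun s => (g s - m) ^+ 2).
  rewrite -[0](expect_cst N); apply: ler_expect => s; exact: sqr_ge0.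
have -> : expect N (fun s => (g s - m) ^+ 2) =
    expect N (fun s => g s ^+ 2) + (- (2 * m) * expect N g + m ^+ 2).
  rewrite -(expect_cst N (m ^+ 2)) -expectZ -!expectD.
  by apply: eq_expect => s; ring.
rewrite -/m; lra.
Qed.

Lemma expect_centered_sum N (f : X -> R) : \sum_x p x * f x = 0 ->
  expect N (fun s => \sum_(a <- s) f a) = 0.
Proof.
move=> f0; elim: N => [|N IH]; first by rewrite expect0 big_nil.
rewrite expectS -[RHS]f0; apply: eq_bigr => x _; congr (_ * _).
under eq_expect do rewrite big_cons.
by rewrite expectD IH expect_cst addr0.
Qed.

Lemma expect_sqr_centered_sum N (f : X -> R) : \sum_x p x * f x = 0 ->
  expect N (fun s => (\sum_(a <- s) f a) ^+ 2) = N%:R * \sum_x p x * f x ^+ 2.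
Proof.
move=> f0; elim: N => [|N IH]; first by rewrite expect0 big_nil expr0n mul0r.
rewrite expectS.
under eq_bigr => x _.
  under eq_expect do rewrite big_cons sqrrD -addrA -mulrnAl.
  rewrite !expectD expect_cst IH expectZ expect_centered_sum // mulr0 add0r.
  rewrite mulrDr; over.
by rewrite big_split -mulr_suml p_sum1 mul1r -natr1 mulrDl mul1r addrC.
Qed.

(** One step of the bounded difference method: [1 + x <= expR x] and
    [expR x <= 1 + x + x ^+ 2] reduce the exponential moment to the variance,
    which is half the mean square of the difference of two independent
    copies. *)
Lemma expectation_exp_bounded (h : X -> R) c lam : 0 <= lam ->
    (forall x x', `|h x - h x'| <= c) -> lam * c <= 16 / 15 ->
  \sum_x p x * expR (lam * h x) <=
  expR (lam * (\sum_x p x * h x) + (lam * c) ^+ 2 / 2).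
Proof.
move=> lam0 hc lamc; set m := \sum_x p x * h x.
have hm x : h x - m = \sum_x' p x' * (h x - h x').
  under [RHS]eq_bigr do rewrite mulrBr.
  by rewrite sumrB -mulr_suml p_sum1 mul1r.
have dev x : h x - m <= c.
  rewrite hm -[c]mul1r -p_sum1 mulr_suml; apply: ler_sum => x' _.
  by rewrite ler_wpM2l //; apply: le_trans (ler_norm _) _.
have var : \sum_x p x * (h x - m) ^+ 2 <= c ^+ 2 / 2.
  have V : \sum_x p x * (h x - m) ^+ 2 = \sum_x p x * h x ^+ 2 - m ^+ 2.
    transitivity (\sum_x (p x * h x ^+ 2 - 2 * m * (p x * h x) + m ^+ 2 * p x)).
      by apply: eq_bigr => x _; ring.
    by rewrite big_split sumrB -!mulr_sumr p_sum1 -/m /=; ring.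
  have D : \sum_x \sum_x' p x * p x' * (h x - h x') ^+ 2 =
      2 * (\sum_x p x * h x ^+ 2 - m ^+ 2).
    transitivity (\sum_x (p x * h x ^+ 2 + p x * (\sum_x' p x' * h x' ^+ 2)
        - 2 * m * (p x * h x))).
      apply: eq_bigr => x _.
      transitivity (\sum_x' (p x * h x ^+ 2 * p x' + p x * (p x' * h x' ^+ 2)
        - 2 * p x * h x * (p x' * h x'))).
        by apply: eq_bigr => x' _; ring.
      by rewrite sumrB big_split -!mulr_sumr p_sum1 -/m /=; ring.
    by rewrite sumrB big_split -mulr_suml -mulr_sumr p_sum1 -/m /=; ring.
  have : \sum_x \sum_x' p x * p x' * (h x - h x') ^+ 2 <= c ^+ 2.
    rewrite -[c ^+ 2]mul1r -p_sum1 mulr_suml; apply: ler_sum => x _.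
    rewrite -[p x * c ^+ 2]mul1r -p_sum1 mulr_suml; apply: ler_sum => x' _.
    rewrite mulrA [p x' * _]mulrC ler_wpM2l ?mulr_ge0 //.
    rewrite -real_normK ?num_real // ler_pXn2r ?nnegrE //.
    exact: le_trans (hc x x').
  by rewrite V; lra.
have -> : \sum_x p x * expR (lam * h x) =
    expR (lam * m) * \sum_x p x * expR (lam * (h x - m)).
  rewrite mulr_sumr; apply: eq_bigr => x _.
  by rewrite mulrCA -expRD -mulrDr addrC subrK.
rewrite expRD ler_wpM2l ?expR_ge0 //; apply: le_trans (expR_ge1Dx _).
have -> : 1 + (lam * c) ^+ 2 / 2 = \sum_x p x * (1 + lam * (h x - m))
    + lam ^+ 2 * (c ^+ 2 / 2).
  have -> : \sum_x p x * (1 + lam * (h x - m)) = 1.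
    transitivity (\sum_x ((1 - lam * m) * p x + lam * (p x * h x))).
      by apply: eq_bigr => x _; ring.
    by rewrite big_split -!mulr_sumr p_sum1 -/m /=; ring.
  by field.
apply: le_trans (lerD (lexx _) (ler_wpM2l (sqr_ge0 lam) var)).
rewrite mulr_sumr -big_split; apply: ler_sum => x _.
rewrite /= mulrCA -mulrDr ler_wpM2l // -exprMn; apply: expR_le_quadratic.
by apply: le_trans lamc; rewrite ler_wpM2l.
Qed.

Definition bounded_differences (g : seq X -> R) c :=
  forall s1 s2 x x', `|g (s1 ++ x :: s2) - g (s1 ++ x' :: s2)| <= c.

(** Induction on the number of draws: averaging over the later draws leaves a
    function of the first one whose values differ by at most [c]. *)
Lemma expect_exp_bounded_differences N g c lam : 0 <= lam ->
    bounded_differences g c -> lam * c <= 16 / 15 ->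
  expect N (fun s => expR (lam * g s)) <=
  expR (lam * expect N g + N%:R * ((lam * c) ^+ 2 / 2)).
Proof.
move=> lam0 + lamc; elim: N g => [|N IH] g gc.
  by rewrite !expect0 mul0r addr0.
rewrite expectS.
have gcx x : bounded_differences (fun s => g (x :: s)) c.
  by move=> s1 s2 a a'; rewrite -!cat_cons.
apply: le_trans (ler_sum _ (fun x _ => ler_wpM2l (p_ge0 x) (IH _ (gcx x)))) _.
rewrite (eq_bigr (fun x => p x * expR (lam * expect N (fun s => g (x :: s)))
  * expR (N%:R * ((lam * c) ^+ 2 / 2)))); last first.
  by move=> x _; rewrite expRD (mulrA (p x)).
rewrite -mulr_suml -[N.+1%:R]natr1 mulrDl mul1r addrA addrAC expRD.
rewrite ler_wpM2r ?expR_ge0 //.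
rewrite expectS; apply: expectation_exp_bounded => // x x'.
have -> : expect N (fun s => g (x :: s)) - expect N (fun s => g (x' :: s)) =
    expect N (fun s => g (x :: s) - g (x' :: s)).
  rewrite -[- expect _ _]mulN1r -expectZ -expectD.
  by apply: eq_expect => s; rewrite mulN1r.
rewrite ler_norml -[- c](expect_cst N) -[X in _ && (_ <= X)](expect_cst N).
by apply/andP; split; apply: ler_expect => s;
  have := gc [::] s x x'; rewrite ler_norml /= => /andP[].
Qed.

(** Euclidean distance from the counts of the outcomes in [s] to their
    expectation, for a sample of size [size s]. *)
Definition count_deviation (s : seq X) : R :=
  l2 (fun x => \sum_(a <- s) ((a == x)%:R - p x)).

(** The vectors of counts of two samples that differ at one position differ by
    1 and -1 at two outcomes. *)
Lemma count_deviation_bounded : bounded_differences count_deviation (Num.sqrt 2).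
Proof.
move=> s1 s2 a a'; apply: le_trans (l2_dist _ _) _.
rewrite ler_sqrt //.
have -> : 2 = \sum_x ((a == x)%:R + (a' == x)%:R) :> R.
  have d b : \sum_x (b == x)%:R = 1 :> R.
    rewrite (bigD1 b) //= eqxx big1 ?addr0 // => x.
    by rewrite eq_sym => /negPf ->.
  by rewrite big_split /= !d.
apply: ler_sum => x _.
rewrite !big_cat !big_cons /=; set u := \sum_(_ <- s1) _; set v := \sum_(_ <- s2) _.
have -> : u + ((a == x)%:R - p x + v) - (u + ((a' == x)%:R - p x + v)) =
    (a == x)%:R - (a' == x)%:R by ring.
by case: (a == x); case: (a' == x); rewrite ?mulr1n ?mulr0n; lra.
Qed.

(** The counts of the outcomes have variances [N * (p x - p x ^+ 2)], whose sum
    is at most [N]. *)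
Lemma expect_count_deviation N : expect N count_deviation <= Num.sqrt N%:R.
Proof.
apply: le_of_sqr; first exact: sqrtr_ge0.
rewrite sqr_sqrtr //; apply: le_trans (sqr_expect_le _ _) _.
under eq_expect do rewrite sqr_l2.
have -> : N%:R = \sum_x N%:R * p x by rewrite -mulr_sumr p_sum1 mulr1.
rewrite expect_sum; apply: ler_sum => x _.
have d1 (f : X -> R) : \sum_a f a * (a == x)%:R = f x.
  rewrite (bigD1 x) //= eqxx mulr1 big1 ?addr0 // => a /negPf ->.
  by rewrite mulr0.
rewrite expect_sqr_centered_sum; last first.
  by under eq_bigr do rewrite mulrBr; rewrite sumrB d1 -mulr_suml p_sum1 mul1r subrr.
rewrite ler_wpM2l //.
have -> : \sum_a p a * ((a == x)%:R - p x) ^+ 2 = p x - p x ^+ 2.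
  transitivity (\sum_a ((1 - 2 * p x) * (p a * (a == x)%:R) + p x ^+ 2 * p a)).
    apply: eq_bigr => a _; case: (a == x); rewrite ?mulr1n ?mulr0n; ring.
  by rewrite big_split -!mulr_sumr d1 p_sum1 /=; ring.
by rewrite gerBl sqr_ge0.
Qed.

(** Chernoff's method with parameter [3 / 4 / sqrt N]: the mean contributes
    [3 / 4] to the exponent and the bounded differences [9 / 16], hence the
    factor [expR (21 / 16) <= 4]. *)
Lemma count_deviation_tail N u : (0 < N)%N ->
  \sum_(t : N.-tuple X | u < count_deviation t) \prod_(x <- t) p x <=
  4 * expR (- (3 / 4 * (u / Num.sqrt N%:R))).
Proof.
move=> N0; set q := Num.sqrt N%:R.
have N0' : 0 < N%:R :> R by rewrite ltr0n.
have q0 : 0 < q by rewrite sqrtr_gt0.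
have q2 : q ^+ 2 = N%:R by rewrite sqr_sqrtr // ltW.
pose lam := 3 / 4 / q.
have lam0 : 0 <= lam by rewrite /lam !divr_ge0 // ltW.
have lamc : lam * Num.sqrt 2 <= 16 / 15.
  apply: le_of_sqr; first lra.
  have iq : (q ^-1) ^+ 2 <= 1 by rewrite exprVn q2 invf_le1 // ler1n.
  by rewrite exprMn sqr_sqrtr // /lam exprMn; lra.
have mgf : expect N (fun s => expR (lam * count_deviation s)) <= 4.
  apply: le_trans
    (expect_exp_bounded_differences _ lam0 count_deviation_bounded lamc) _.
  apply: le_trans expR_21_16_le4; rewrite ler_expR.
  have h1 : lam * expect N count_deviation <= 3 / 4.
    apply: le_trans (ler_wpM2l lam0 (expect_count_deviation N)) _.
    by rewrite -/q /lam divfK ?gt_eqF.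
  have h2 : N%:R * ((lam * Num.sqrt 2) ^+ 2 / 2) = 9 / 16.
    rewrite exprMn sqr_sqrtr // /lam -q2; field; exact: lt0r_neq0.
  lra.
have -> : - (3 / 4 * (u / q)) = - (lam * u) by rewrite /lam; ring.
rewrite expRN ler_pdivlMr ?expR_gt0 //; apply: le_trans mgf.
rewrite /expect mulr_suml.
rewrite [leRHS](bigID (fun t : N.-tuple X => u < count_deviation t)) /=.
have w0 (t : seq X) : 0 <= \prod_(x <- t) p x by apply: prodr_ge0.
rewrite -[leLHS]addr0 lerD //.
  apply: ler_sum => t ut; rewrite ler_wpM2l // ler_expR ler_wpM2l //; exact: ltW.
by apply: sumr_ge0 => t _; rewrite mulr_ge0 ?expR_ge0.
Qed.

End ProductExpectation.

(** * Multi-indices and unfoldings *)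

Section IndexTheory.
Variables (L : nat) (n : 'I_(2 ^ L) -> nat).

Lemma midx_irr (C : {set 'I_(2 ^ L)}) (c : midx n C) i (h1 h2 : i \in C) :
  c (exist _ i h1) = c (exist _ i h2).
Proof. by rewrite (bool_irrelevance h1 h2). Qed.

Lemma pick2l (A B : {set 'I_(2 ^ L)}) (a : midx n A) (b : midx n B) i
    (iAB : i \in (A :|: B)%SET) (iA : i \in A) :
  pick2 a b iAB = a (exist _ i iA).
Proof.
rewrite /pick2; move: (boolP (i \in A)).
suff gen c (h : alt_spec (i \in A) (i \in A) c) :
    match h with
    | AltTrue hA => a (exist _ i hA)
    | AltFalse hA => b (exist _ i (in_setU_right iAB hA))
    end = a (exist _ i iA) by move=> h; exact: gen.
by case: h => hA; [rewrite (bool_irrelevance hA iA)|case/negP: (hA)].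
Qed.

Lemma pick2r (A B : {set 'I_(2 ^ L)}) (a : midx n A) (b : midx n B) i
    (iAB : i \in (A :|: B)%SET) (iB : i \in B) : i \notin A ->
  pick2 a b iAB = b (exist _ i iB).
Proof.
move=> iA; rewrite /pick2; move: (boolP (i \in A)).
suff gen c (h : alt_spec (i \in A) (i \in A) c) :
    match h with
    | AltTrue hA => a (exist _ i hA)
    | AltFalse hA => b (exist _ i (in_setU_right iAB hA))
    end = b (exist _ i iB) by move=> h; exact: gen.
case: h => hA; first by case/negP: (iA).
by rewrite (bool_irrelevance (in_setU_right iAB hA) iB).
Qed.

Lemma cluster_disjoint l k i :
  i \in cluster L l.+1 k.*2.+1 -> i \notin cluster L l.+1 k.*2.
Proof. by rewrite !inE => /andP[h _]; rewrite negb_and -!leqNgt h orbT. Qed.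

Lemma glue_restr l k (lL : (l < L)%N) (c : Iidx n l k) :
  glue (cluster_cover k lL) (restr (cluster_left k lL) c)
                            (restr (cluster_right k lL) c) = c.
Proof.
apply/ffunP => -[i hi]; rewrite ffunE /=.
have [iA|iA] := boolP (i \in cluster L l.+1 k.*2).
  by rewrite (pick2l _ _ _ iA) ffunE /=; exact: midx_irr.
have iB : i \in cluster L l.+1 k.*2.+1.
  have := fintype.subsetP (cluster_cover k lL) _ hi.
  by rewrite finset.in_setU (negbTE iA).
by rewrite (pick2r _ _ _ iB iA) ffunE /=; exact: midx_irr.
Qed.

Lemma restr_left_glue l k (lL : (l < L)%N) (a : Iidx n l.+1 k.*2)
    (b : Iidx n l.+1 k.*2.+1) :
  restr (cluster_left k lL) (glue (cluster_cover k lL) a b) = a.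
Proof. by apply/ffunP => -[i hi]; rewrite !ffunE /= (pick2l _ _ _ hi). Qed.

Lemma restr_right_glue l k (lL : (l < L)%N) (a : Iidx n l.+1 k.*2)
    (b : Iidx n l.+1 k.*2.+1) :
  restr (cluster_right k lL) (glue (cluster_cover k lL) a b) = b.
Proof.
apply/ffunP => -[i hi]; rewrite !ffunE /= (pick2r _ _ _ hi) //.
exact: cluster_disjoint hi.
Qed.

Lemma trestr_join (C : {set 'I_(2 ^ L)}) (a : midx n C) (b : midx n (~: C)%SET) :
  trestr C (join a b) = a.
Proof. by apply/ffunP => -[i hi]; rewrite !ffunE /= (pick2l _ _ _ hi). Qed.

Lemma trestrC_join (C : {set 'I_(2 ^ L)}) (a : midx n C) (b : midx n (~: C)%SET) :
  trestr (~: C)%SET (join a b) = b.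
Proof.
apply/ffunP => -[i hi]; rewrite !ffunE /= (pick2r _ _ _ hi) //.
by move: hi; rewrite finset.in_setC.
Qed.

Lemma join_trestr (C : {set 'I_(2 ^ L)}) (x : tidx n) :
  join (trestr C x) (trestr (~: C)%SET x) = x.
Proof.
apply/ffunP => i; rewrite ffunE.
have [iC|iC] := boolP (i \in C); first by rewrite (pick2l _ _ _ iC) ffunE.
have iC' : i \in (~: C)%SET by rewrite finset.in_setC.
by rewrite (pick2r _ _ _ iC' iC) ffunE.
Qed.

Lemma Jidx0_singleton (b b' : Jidx n 0 0) : b = b'.
Proof.
apply/ffunP => -[i hi]; exfalso; move: hi.
by rewrite !inE subn0 mul0n mul1n leq0n ltn_ord.
Qed.

Context {R : realType}.

Lemma sum_glue l k (lL : (l < L)%N) (F : Iidx n l k -> R) :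
  \sum_(i < #|{: Iidx n l k}|) F (enum_val i) =
  \sum_(a < #|{: Iidx n l.+1 k.*2}|) \sum_(b < #|{: Iidx n l.+1 k.*2.+1}|)
    F (glue (cluster_cover k lL) (enum_val a) (enum_val b)).
Proof.
rewrite pair_bigA /=.
pose f (i : 'I_#|{: Iidx n l k}|) := (enum_rank (restr (cluster_left k lL) (enum_val i)),
             enum_rank (restr (cluster_right k lL) (enum_val i))).
pose g (e : 'I_#|{: Iidx n l.+1 k.*2}| * 'I_#|{: Iidx n l.+1 k.*2.+1}|) :=
  enum_rank (glue (cluster_cover k lL) (enum_val e.1) (enum_val e.2)).
have gf : cancel f g by move=> i; rewrite /f /g /= !enum_rankK glue_restr enum_valK.
have fg : cancel g f.
  move=> [a b]; rewrite /f /g /= !enum_rankK restr_left_glue restr_right_glue.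
  by rewrite !enum_valK.
rewrite (reindex g) /=; last by apply: onW_bij; exists f.
by apply: eq_bigr => e _; rewrite /g enum_rankK.
Qed.

Lemma sum_join (C : {set 'I_(2 ^ L)}) (F : tidx n -> R) :
  \sum_x F x =
  \sum_(a < #|{: midx n C}|) \sum_(b < #|{: midx n (~: C)%SET}|)
    F (join (enum_val a) (enum_val b)).
Proof.
rewrite pair_bigA /=.
pose f (x : tidx n) := (enum_rank (trestr C x), enum_rank (trestr (~: C)%SET x)).
pose g (e : 'I_#|{: midx n C}| * 'I_#|{: midx n (~: C)%SET}|) :=
  join (enum_val e.1) (enum_val e.2).
have gf : cancel f g by move=> x; rewrite /f /g /= !enum_rankK join_trestr.
have fg : cancel g f.
  by move=> [a b]; rewrite /f /g /= trestr_join trestrC_join !enum_valK.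
by rewrite (reindex g) //=; apply: onW_bij; exists f.
Qed.

Lemma card_Jidx0 : inhabited (tidx n) -> #|{: Jidx n 0 0}| = 1%N.
Proof.
move=> [x]; pose b0 : Jidx n 0 0 := trestr (~: cluster L 0 0)%SET x.
apply: (etrans _ (card1 b0)); apply: eq_card => b; rewrite !inE.
exact/esym/eqP/Jidx0_singleton.
Qed.

(** Frobenius norm of the three-index tensor with slices [Z g]. *)
Definition tfrob m1 m2 r (Z : 'I_r -> 'M[R]_(m1, m2)) : R := l2 (fun g => frob (Z g)).

Lemma eq_tfrob m1 m2 r (Z W : 'I_r -> 'M[R]_(m1, m2)) : Z =1 W -> tfrob Z = tfrob W.
Proof. by move=> ZW; apply: eq_l2 => g; rewrite ZW. Qed.

Lemma tfrobD m1 m2 r (Z W : 'I_r -> 'M[R]_(m1, m2)) :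
  tfrob (fun g => Z g + W g) <= tfrob Z + tfrob W.
Proof.
apply: le_trans (l2D _ _); apply: ler_l2 => g.
by rewrite ger0_norm ?frob_ge0 // frobD.
Qed.

Lemma ler_tfrob m1 m2 m1' m2' r (Z : 'I_r -> 'M[R]_(m1, m2))
    (W : 'I_r -> 'M[R]_(m1', m2')) c : 0 <= c ->
  (forall g, frob (Z g) <= c * frob (W g)) -> tfrob Z <= c * tfrob W.
Proof.
move=> c0 ZW; rewrite -l2Z //; apply: ler_l2 => g.
by rewrite ger0_norm ?frob_ge0.
Qed.

Lemma frob_slice l k (lL : (l < L)%N) r (M : 'M[R]_(#|{: Iidx n l k}|, r)) :
  frob M = tfrob (slice lL M).
Proof.
congr Num.sqrt; rewrite exchange_big; apply: eq_bigr => g _.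
rewrite sqr_frob (eq_bigr (fun i => M (enum_rank (enum_val i)) g ^+ 2)).
  rewrite (sum_glue lL (fun c => M (enum_rank c) g ^+ 2)).
  by apply: eq_bigr => a _; apply: eq_bigr => b _; rewrite mxE.
by move=> i _; rewrite enum_valK.
Qed.

Lemma slice_merge l k (lL : (l < L)%N) r
    (Z : 'I_r -> 'M[R]_(#|{: Iidx n l.+1 k.*2}|, #|{: Iidx n l.+1 k.*2.+1}|)) g :
  slice lL (merge lL Z) g = Z g.
Proof.
apply/matrixP => a b; rewrite !mxE !enum_rankK restr_left_glue restr_right_glue.
by rewrite !enum_valK.
Qed.

Lemma sliceB l k (lL : (l < L)%N) r (M N : 'M[R]_(#|{: Iidx n l k}|, r)) g :
  slice lL (M - N) g = slice lL M g - slice lL N g.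
Proof. by apply/matrixP => a b; rewrite !mxE. Qed.

Lemma frob_unfold (p : tidx n -> R) l k : frob (unfold p l k) = tnorm p.
Proof.
congr Num.sqrt; rewrite (sum_join (cluster L l k)).
by apply: eq_bigr => a _; apply: eq_bigr => b _; rewrite mxE.
Qed.

Lemma unfoldB (p q : tidx n -> R) l k :
  unfold (fun x => p x - q x) l k = unfold p l k - unfold q l k.
Proof. by apply/matrixP => a b; rewrite !mxE. Qed.

End IndexTheory.

(** * Error propagation along the tree *)

Section Families.
Context {R : realType}.

Lemma frob_sandwich m1 m2 q1 q2 (X : 'M[R]_(m1, q1)) (Y : 'M[R]_(m2, q2)) x y G :
  specnorm X <= x -> specnorm Y <= y -> frob (X *m G *m Y^T) <= x * y * frob G.
Proof.
move=> Xx Yy; apply: le_trans (frob_mulmxr _ _) _; rewrite mulrAC mulrC.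
rewrite ler_pM ?specnorm_ge0 ?frob_ge0 //.
by apply: le_trans (frob_mulmxl _ _) _; rewrite ler_wpM2r ?frob_ge0.
Qed.

Lemma tfrob_sandwich m1 m2 q1 q2 s (X : 'M[R]_(m1, q1)) (Y : 'M[R]_(m2, q2)) x y
    (G : 'I_s -> 'M[R]_(q1, q2)) : specnorm X <= x -> specnorm Y <= y ->
  tfrob (fun g => X *m G g *m Y^T) <= x * y * tfrob G.
Proof.
move=> Xx Yy; apply: ler_tfrob => [|g]; last exact: frob_sandwich.
by rewrite mulr_ge0 ?(le_trans (specnorm_ge0 _) Xx) ?(le_trans (specnorm_ge0 _) Yy).
Qed.

(** Telescoping, with the middle factor perturbed first: the perturbation of
    the outer factors then multiplies the unperturbed core [G]. *)
Lemma tfrob_core_perturbation m1 m2 q1 q2 s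
    (X' X : 'M[R]_(m1, q1)) (Y' Y : 'M[R]_(m2, q2))
    (G' G : 'I_s -> 'M[R]_(q1, q2)) (c' c e : R) :
    frob X' <= c' -> frob Y' <= c' -> frob X <= c ->
    frob (X' - X) <= e -> frob (Y' - Y) <= e ->
  tfrob (fun g => X' *m G' g *m Y'^T - X *m G g *m Y^T) <=
  c' ^+ 2 * tfrob (fun g => G' g - G g) + (c' + c) * e * tfrob G.
Proof.
have spec m n (M : 'M[R]_(m, n)) b : frob M <= b -> specnorm M <= b.
  exact: le_trans (specnorm_le_frob _).
move=> /spec hX' /spec hY' /spec hX /spec hXe /spec hYe.
rewrite (@eq_tfrob _ _ _ _ _ (fun g => X' *m (G' g - G g) *m Y'^T
   + ((X' - X) *m G g *m Y'^T + X *m G g *m (Y' - Y)^T))); last first.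
  move=> g; have -> : (Y' - Y)^T = Y'^T - Y^T by rewrite linearB.
  by rewrite !(mulmxBr, mulmxBl) !addrA !subrK.
apply: le_trans (tfrobD _ _) _; apply: lerD.
  by rewrite expr2; exact: tfrob_sandwich.
apply: le_trans (tfrobD _ _) _; rewrite mulrDl mulrDl.
by rewrite [c' * e]mulrC; apply: lerD; exact: tfrob_sandwich.
Qed.

Lemma range_unfold3 m1 m2 s q (Z : 'I_s -> 'M[R]_(m1, m2)) (Q : 'M[R]_(m1, q)) :
  range_sub (unfold3 Z) Q -> forall g, exists W, Z g = Q *m W.
Proof.
move=> /range_subP[W ZW] g.
exists (\matrix_(i, b) W i (enum_rank (b, g))); apply/matrixP => a b.
have /matrixP/(_ a (enum_rank (b, g))) := ZW.
by rewrite !mxE enum_rankK /= => ->; apply: eq_bigr => i _; rewrite mxE.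
Qed.

End Families.

Section ErrorPropagation.
Context {R : realType}.
Variables (L : nat) (n : 'I_(2 ^ L) -> nat) (pstar : tidx n -> R).
Variables (rt : nat -> nat)
  (S : forall l k : nat, 'M[R]_(#|{: Iidx n l k}|, rt l))
  (T : forall l k : nat, 'M[R]_(#|{: Jidx n l k}|, rt l))
  (r : nat -> nat)
  (Pr : nat -> forall m1 m2 : nat, 'M[R]_(m1, m2) -> 'M[R]_(m1, m2)).
Hypothesis rt0 : rt 0%N = 1%N.
Hypothesis tidx_inhabited : inhabited (tidx n).

Lemma level_child l k : (k < 2 ^ l)%N ->
  (k.*2 < 2 ^ l.+1)%N /\ (k.*2.+1 < 2 ^ l.+1)%N.
Proof.
move=> kl; have : (k.+1.*2 <= 2 ^ l.+1)%N by rewrite expnS mul2n leq_double.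
by rewrite doubleS => h; split=> //; exact: ltnW.
Qed.

Lemma sketchedB (p q : tidx n -> R) l k :
  sketched T (fun x => p x - q x) l k = sketched T p l k - sketched T q l k.
Proof. by rewrite /sketched unfoldB mulmxBl. Qed.

Lemma top_index (i : 'I_(rt 0)) : i = 0%N :> nat.
Proof. by apply/eqP; rewrite -leqn0 -ltnS -rt0. Qed.

Lemma sketched_top (p : tidx n -> R) x g :
  sketched T p 0 0 (enum_rank (trestr (cluster L 0 0) x)) g = p x.
Proof.
rewrite /sketched /= mxE.
pose b := enum_rank (trestr (~: cluster L 0 0)%SET x : Jidx n 0 0).
rewrite (bigD1 b) //= big1 ?addr0 => [|b' b'b].
  by rewrite !mxE mulr1 /b !enum_rankK join_trestr.
by case/eqP: b'b; apply: enum_val_inj; exact: Jidx0_singleton.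
Qed.

Lemma tnorm_top (M : 'M[R]_(#|{: Iidx n 0 0}|, rt 0)) :
  tnorm (fun x => M (enum_rank (trestr (cluster L 0 0) x))
                    (cast_ord (esym rt0) ord0)) = frob M.
Proof.
congr Num.sqrt; rewrite exchange_big /=.
rewrite (bigD1 (cast_ord (esym rt0) ord0)) //= [X in _ + X]big1 ?addr0; last first.
  by move=> g /eqP[]; apply: val_inj; rewrite /= top_index.
rewrite (sum_join (cluster L 0 0)); apply: eq_bigr => a _.
rewrite (eq_bigr (fun=> M a (cast_ord (esym rt0) ord0) ^+ 2)); last first.
  by move=> b _; rewrite trestr_join enum_valK.
by rewrite big_const_ord card_Jidx0 //= addr0.
Qed.

Hypothesis orthonormal_sketches : forall l k, (1 <= l <= L)%N -> (k < 2 ^ l)%N ->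
  orthonormal_cols (S l k) /\ orthonormal_cols (T l k).

(** At the root the all-ones matrix has a single entry, so it also has
    orthonormal columns. *)
Lemma frob_sketched (p : tidx n -> R) l k : (l <= L)%N -> (k < 2 ^ l)%N ->
  frob (sketched T p l k) <= tnorm p.
Proof.
move=> lL kl; rewrite -(frob_unfold p l k) /sketched.
case: l lL kl => [|l] lL kl /=; last first.
  by apply: frob_orthonormalr; exact: (orthonormal_sketches _ kl).2.
case: k kl => // _; apply: frob_orthonormalr => i j.
have -> : i = j by apply: val_inj; rewrite /= !top_index.
rewrite eqxx (eq_bigr (fun=> 1)); last by move=> a _; rewrite !mxE mulr1.
by rewrite big_const_ord card_Jidx0 //= addr0.
Qed.

Lemma frob_slice_sketch l k (lL : (l < L)%N) (k2 : (k < 2 ^ l)%N) m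
    (M : 'M[R]_(#|{: Iidx n l k}|, m)) :
  tfrob (fun g => (S l.+1 k.*2)^T *m slice lL M g *m S l.+1 k.*2.+1) <= frob M.
Proof.
rewrite (frob_slice lL); have [k2l k2r] := level_child k2.
rewrite -[leRHS]mul1r; apply: ler_tfrob => // g; rewrite mul1r.
apply: le_trans (frob_orthonormalr _ (orthonormal_sketches _ k2r).1) _ => //.
exact: frob_orthonormal_tr (orthonormal_sketches _ k2l).1.
Qed.

Hypothesis range_S : forall l k, (1 <= l <= L)%N -> (k < 2 ^ l)%N ->
  range_eq ((unfold pstar l k)^T *m S l k) (unfold pstar l k)^T.

(** The rows of [sketched T pstar l k] are combinations of those of
    [Amx S T pstar l k], so the projector onto the row space of the latter
    fixes them. *)
Lemma sketched_recover l k : (1 <= l <= L)%N -> (k < 2 ^ l)%N ->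
  let A := Amx S T pstar l k in
  sketched T pstar l k *m pinv A *m A = sketched T pstar l k.
Proof.
move=> lL kl A; have [A1 _ _ _] := pinvP A.
have /andP[_ /range_subP[W UW]] := range_S lL kl.
have -> : sketched T pstar l k = W^T *m A.
  rewrite /A /Amx /sketched !mulmxA; congr (_ *m _).
  by rewrite -[LHS]trmxK UW !trmx_mul !trmxK mulmxA.
by clearbody A; rewrite -!mulmxA (mulmxA A) A1.
Qed.

Hypothesis range_children : forall l k (lL : (l < L)%N), (k < 2 ^ l)%N ->
  let Z := slice lL (sketched T pstar l k) in
  range_sub (unfold3 Z) (sketched T pstar l.+1 k.*2) /\
  range_sub (unfold3 (fun g => (Z g)^T)) (sketched T pstar l.+1 k.*2.+1).

(** The core that [Gmx] computes from [pstar], with the truncation left out: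
    the rank of [Amx] at [pstar] is at most [r] already. *)
Definition exact_core l k (lL : (l < L)%N) (g : 'I_(rt l)) : 'M[R]_(rt l.+1) :=
  pinv (Amx S T pstar l.+1 k.*2) *m Bmx S T pstar k lL g
    *m (pinv (Amx S T pstar l.+1 k.*2.+1))^T.

Section Node.
Variables (l k : nat) (lL : (l < L)%N) (k2 : (k < 2 ^ l)%N).
Local Notation A1 := (Amx S T pstar l.+1 k.*2).
Local Notation A2 := (Amx S T pstar l.+1 k.*2.+1).

(** The two following lemmas make [pinv_perturbation] applicable to [Bmx]. *)
Lemma Bmx_range_left g :
  A1 *m pinv A1 *m Bmx S T pstar k lL g = Bmx S T pstar k lL g.
Proof.
have [h _ _ _] := pinvP A1.
have [W ZW] := range_unfold3 (range_children lL k2).1 g.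
have -> : Bmx S T pstar k lL g = A1 *m W *m S l.+1 k.*2.+1.
  by rewrite /Bmx ZW /Amx !mulmxA.
by rewrite -(mulmxA _ W) mulmxA h.
Qed.

Lemma Bmx_range_right g :
  A2 *m pinv A2 *m (Bmx S T pstar k lL g)^T = (Bmx S T pstar k lL g)^T.
Proof.
have [h _ _ _] := pinvP A2.
have [W ZW] := range_unfold3 (range_children lL k2).2 g.
have -> : (Bmx S T pstar k lL g)^T = A2 *m W *m S l.+1 k.*2.
  by rewrite /Bmx !trmx_mul trmxK ZW /Amx !mulmxA.
by rewrite -(mulmxA _ W) mulmxA h.
Qed.

(** Exact recovery: the tree contraction is the identity on [pstar]. *)
Lemma slice_recover g :
  slice lL (sketched T pstar l k) g =
  sketched T pstar l.+1 k.*2 *m exact_core k lL g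
    *m (sketched T pstar l.+1 k.*2.+1)^T.
Proof.
have [k2l k2r] := level_child k2.
have [W1 ZW1] := range_unfold3 (range_children lL k2).1 g.
have [W2 ZW2] := range_unfold3 (range_children lL k2).2 g.
have h1 : sketched T pstar l.+1 k.*2 *m pinv A1 *m
    ((S l.+1 k.*2)^T *m slice lL (sketched T pstar l k) g) =
    slice lL (sketched T pstar l k) g.
  by rewrite ZW1 (mulmxA (S _ _)^T) -/(Amx S T pstar _ _) mulmxA sketched_recover.
have h2 : sketched T pstar l.+1 k.*2.+1 *m pinv A2 *m
    ((S l.+1 k.*2.+1)^T *m (slice lL (sketched T pstar l k) g)^T) =
    (slice lL (sketched T pstar l k) g)^T.
  by rewrite ZW2 (mulmxA (S _ _)^T) -/(Amx S T pstar _ _) mulmxA sketched_recover.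
apply: trmx_inj; rewrite -[LHS]h2 -{1}h1.
by rewrite /exact_core /Bmx !trmx_mul !trmxK !mulmxA.
Qed.

End Node.

Variables (phat : tidx n -> R) (cA cAh cp cpt : R).
Hypothesis L_ge1 : (1 <= L)%N.
Hypothesis Pr_best : forall (s m1 m2 : nat) (M : 'M[R]_(m1, m2)),
  best_rank_approx s M (Pr s M).
Hypothesis rank_pstar : forall l k, (1 <= l <= L)%N -> (k < 2 ^ l)%N ->
  \rank (unfold pstar l k) = r l.
Hypothesis bound_A : forall l k, (1 <= l <= L)%N -> (k < 2 ^ l)%N ->
  specnorm (pinv (Amx S T pstar l k)) <= cA.
Hypothesis bound_Ahat : forall l k, (1 <= l <= L)%N -> (k < 2 ^ l)%N ->
  specnorm (pinv (PAmx S T r Pr phat l k)) <= cAh.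
Hypothesis bound_p : forall l k, (1 <= l <= L)%N -> (k < 2 ^ l)%N ->
  frob (sketched T pstar l k) <= cp.
Hypothesis bound_ptilde : forall l k (lL : (l <= L)%N),
  (1 <= l)%N -> (k < 2 ^ l)%N -> frob (estim_mx S T r Pr phat lL k) <= cpt.
Hypothesis bound_pstar : tnorm pstar <= cp.

Definition sampling_error := tnorm (fun x => phat x - pstar x).
Local Notation eta := sampling_error.

Lemma sampling_error_ge0 : 0 <= eta. Proof. exact: sqrtr_ge0. Qed.

Lemma cA_ge0 : 0 <= cA.
Proof. by apply: le_trans (specnorm_ge0 _) (@bound_A 1 0 _ _). Qed.

Lemma cAh_ge0 : 0 <= cAh.
Proof. by apply: le_trans (specnorm_ge0 _) (@bound_Ahat 1 0 _ _). Qed.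

Lemma cp_ge0 : 0 <= cp.
Proof. exact: le_trans (sqrtr_ge0 _) bound_pstar. Qed.

Lemma cpt_ge0 : 0 <= cpt.
Proof. by apply: le_trans (frob_ge0 _) (@bound_ptilde 1 0 L_ge1 _ _). Qed.

Lemma sketched_close l k : (l <= L)%N -> (k < 2 ^ l)%N ->
  frob (sketched T phat l k - sketched T pstar l k) <= eta.
Proof. by move=> lL kl; rewrite -sketchedB frob_sketched. Qed.

Lemma sketched_pstar_le l k : (l <= L)%N -> (k < 2 ^ l)%N ->
  frob (sketched T pstar l k) <= cp.
Proof. by move=> lL kl; apply: le_trans (frob_sketched _ _ _) bound_pstar. Qed.

(** The factor 2 is the price of the truncation. *)
Lemma PAmx_close l k : (1 <= l <= L)%N -> (k < 2 ^ l)%N ->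
  specnorm (PAmx S T r Pr phat l k - Amx S T pstar l k) <= 2 * eta.
Proof.
move=> lL kl; apply: le_trans (best_rank_approx_dist (Pr_best _ _) _) _.
  rewrite -(rank_pstar lL kl) /Amx /sketched.
  by apply: leq_trans (mxrankM_maxr _ _) _; exact: mxrankM_maxl.
rewrite ler_wpM2l // /Amx -mulmxBr; apply: le_trans (specnorm_le_frob _) _.
apply: le_trans (frob_orthonormal_tr _ (orthonormal_sketches lL kl).1) _.
by apply: sketched_close; case/andP: lL.
Qed.

Section Core.
Variables (l k : nat) (lL : (l < L)%N) (k2 : (k < 2 ^ l)%N).
Local Notation A1 := (Amx S T pstar l.+1 k.*2).
Local Notation A2 := (Amx S T pstar l.+1 k.*2.+1).
Local Notation Ah1 := (PAmx S T r Pr phat l.+1 k.*2).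
Local Notation Ah2 := (PAmx S T r Pr phat l.+1 k.*2.+1).

Lemma Bmx_close :
  tfrob (fun g => Bmx S T phat k lL g - Bmx S T pstar k lL g) <= eta.
Proof.
apply: le_trans (sketched_close (ltnW lL) k2).
rewrite (@eq_tfrob _ _ _ _ _ (fun g => (S l.+1 k.*2)^T *m
  slice lL (sketched T phat l k - sketched T pstar l k) g *m S l.+1 k.*2.+1)).
  exact: frob_slice_sketch.
by move=> g; rewrite sliceB mulmxBr mulmxBl.
Qed.

Lemma Bmx_le : tfrob (Bmx S T pstar k lL) <= cp.
Proof.
exact: le_trans (frob_slice_sketch lL k2 _) (sketched_pstar_le (ltnW lL) k2).
Qed.

Lemma exact_core_le : tfrob (exact_core k lL) <= cA ^+ 2 * cp.
Proof.
have [k2l k2r] := level_child k2.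
apply: le_trans (tfrob_sandwich _ (bound_A _ k2l) (bound_A _ k2r)) _ => //.
by rewrite -expr2 ler_wpM2l ?sqr_ge0 ?Bmx_le.
Qed.

Lemma Gmx_le : tfrob (Gmx S T r Pr phat k lL) <= cAh ^+ 2 * (cp + eta).
Proof.
have [k2l k2r] := level_child k2.
rewrite (@eq_tfrob _ _ _ _ _
  (fun g => pinv Ah1 *m Bmx S T phat k lL g *m (pinv Ah2)^T)); last first.
  by move=> g; rewrite /Gmx pinv_tr.
apply: le_trans (tfrob_sandwich _ (bound_Ahat _ k2l) (bound_Ahat _ k2r)) _ => //.
rewrite -expr2 ler_wpM2l ?sqr_ge0 //.
rewrite (@eq_tfrob _ _ _ _ _ (fun g => Bmx S T pstar k lL g
  + (Bmx S T phat k lL g - Bmx S T pstar k lL g))); last first.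
  by move=> g; rewrite addrC subrK.
by apply: le_trans (tfrobD _ _) _; rewrite lerD ?Bmx_le ?Bmx_close.
Qed.

(** Telescoping, with each difference of pseudo-inverses applied to the exact
    [Bmx], where [pinv_perturbation] controls it with [e = 2 * eta]. *)
Lemma Gmx_close : eta * cA <= 4 / 9 ->
  tfrob (fun g => Gmx S T r Pr phat k lL g - exact_core k lL g) <=
  (cAh ^+ 2 + 11 * cA * cAh ^+ 2 * cp + 11 * cA ^+ 2 * cAh * cp) * eta.
Proof.
move=> etaA; have [k2l k2r] := level_child k2.
have e0 := sampling_error_ge0; have a0 := cA_ge0; have b0 := cAh_ge0.
have lL' : (1 <= l.+1 <= L)%N by [].
have ea : 2 * eta * cA <= 8 / 9 by lra.
set B := Bmx S T pstar k lL; set Bh := Bmx S T phat k lL.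
rewrite (@eq_tfrob _ _ _ _ _ (fun g =>
    pinv Ah1 *m (Bh g - B g) *m (pinv Ah2)^T
    + (1%:M *m ((pinv Ah1 - pinv A1) *m B g) *m (pinv Ah2)^T
    + pinv A1 *m ((pinv Ah2 - pinv A2) *m (B g)^T)^T *m 1%:M^T))); last first.
  move=> g; rewrite /Gmx /exact_core -/B -/Bh pinv_tr trmx1 mul1mx mulmx1.
  have -> : ((pinv Ah2 - pinv A2) *m (B g)^T)^T =
      B g *m (pinv Ah2)^T - B g *m (pinv A2)^T.
    by rewrite trmx_mul trmxK linearB mulmxBr.
  by rewrite !(mulmxBr, mulmxBl) !mulmxA !addrA !subrK.
have spec1 m : specnorm (1%:M : 'M[R]_m) <= 1.
  by apply: specnorm_le => // x; rewrite mul1mx mul1r.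
have hB := Bmx_le; have hD := Bmx_close; have hc := cp_ge0.
have hD1 : tfrob (fun g => (pinv Ah1 - pinv A1) *m B g) <=
    11 / 2 * (2 * eta * cA * cAh) * cp.
  apply: le_trans (ler_wpM2l _ hB); last by rewrite !mulr_ge0.
  apply: ler_tfrob => [|g]; first by rewrite !mulr_ge0.
  exact: (pinv_perturbation (bound_A lL' k2l) (bound_Ahat lL' k2l)
    (PAmx_close lL' k2l) ea (Bmx_range_left lL k2 g)).
have hD2 : tfrob (fun g => ((pinv Ah2 - pinv A2) *m (B g)^T)^T) <=
    11 / 2 * (2 * eta * cA * cAh) * cp.
  apply: le_trans (ler_wpM2l _ hB); last by rewrite !mulr_ge0.
  apply: ler_tfrob => [|g]; first by rewrite !mulr_ge0.
  rewrite frob_tr -[frob (B g)]frob_tr.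
  exact: (pinv_perturbation (bound_A lL' k2r) (bound_Ahat lL' k2r)
    (PAmx_close lL' k2r) ea (Bmx_range_right lL k2 g)).
apply: le_trans (tfrobD _ _) _; apply: le_trans (lerD (lexx _) (tfrobD _ _)) _.
have h0 : tfrob (fun g => pinv Ah1 *m (Bh g - B g) *m (pinv Ah2)^T) <=
    cAh * cAh * eta.
  apply: le_trans (tfrob_sandwich _ (bound_Ahat _ k2l) (bound_Ahat _ k2r)) _ => //.
  by rewrite ler_wpM2l ?mulr_ge0.
have h1 : tfrob (fun g => 1%:M *m ((pinv Ah1 - pinv A1) *m B g) *m (pinv Ah2)^T)
    <= 1 * cAh * (11 / 2 * (2 * eta * cA * cAh) * cp).
  apply: le_trans (tfrob_sandwich _ (spec1 _) (bound_Ahat _ k2r)) _ => //.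
  by rewrite ler_wpM2l ?mulr_ge0.
have h2 : tfrob (fun g =>
      pinv A1 *m ((pinv Ah2 - pinv A2) *m (B g)^T)^T *m 1%:M^T)
    <= cA * 1 * (11 / 2 * (2 * eta * cA * cAh) * cp).
  apply: le_trans (tfrob_sandwich _ (bound_A _ k2l) (spec1 _)) _ => //.
  by rewrite ler_wpM2l ?mulr_ge0.
apply: le_trans (lerD h0 (lerD h1 h2)) _; lra.
Qed.

End Core.

Lemma estim_recE j l (e : (l + j = L)%N) (lL : (l <= L)%N) k :
  estim_rec S T r Pr phat e k = estim_mx S T r Pr phat lL k.
Proof.
rewrite /estim_mx; have jE : j = (L - l)%N by rewrite -e addKn.
by move: e; rewrite jE => e; rewrite (eq_irrelevance e (subnKC lL)).
Qed.

Lemma estim_rec_le j l (e : (l + j = L)%N) k : (1 <= l)%N -> (k < 2 ^ l)%N ->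
  frob (estim_rec S T r Pr phat e k) <= cpt.
Proof.
move=> l1 kl; have lL : (l <= L)%N by rewrite -e leq_addr.
by rewrite (estim_recE e lL) bound_ptilde.
Qed.

Definition contraction_rate := cA ^+ 2 * cp * cpt + cA ^+ 2 * cp ^+ 2.
Local Notation rho := contraction_rate.
Hypothesis rho_gt1 : 1 < rho.

(** The recursion [error <= rho * error + kappa] has the fixed point
    [- kappa / (rho - 1)]; the distance to it is multiplied by at most [rho] at
    each level. *)
Lemma estim_rec_error kappa j l (e : (l + j = L)%N) k : (k < 2 ^ l)%N ->
    (forall l k (lL : (l < L)%N), (k < 2 ^ l)%N ->
      cpt ^+ 2 * tfrob (fun g => Gmx S T r Pr phat k lL g - exact_core k lL g)
        <= kappa) ->
  frob (estim_rec S T r Pr phat e k - sketched T pstar l k) + kappa / (rho - 1)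
    <= rho ^+ j * (eta + kappa / (rho - 1)).
Proof.
move=> + hkappa; elim: j l e k => [|j IH] l e k kl.
  rewrite expr0 mul1r lerD2r /=; apply: sketched_close => //.
  by rewrite -e leq_addr.
have lL := level_lt e; have [k2l k2r] := level_child kl.
set beta := rho ^+ j * (eta + kappa / (rho - 1)) in IH.
have err := IH _ (level_succ e).
have childl := err _ k2l; have childr := err _ k2r.
rewrite -lerBrDr in childl; rewrite -lerBrDr in childr.
have := @tfrob_core_perturbation _ _ _ _ _ _
  (estim_rec S T r Pr phat (level_succ e) k.*2) (sketched T pstar l.+1 k.*2)
  (estim_rec S T r Pr phat (level_succ e) k.*2.+1) (sketched T pstar l.+1 k.*2.+1)
  (Gmx S T r Pr phat k lL) (exact_core k lL) cpt cp _
  (estim_rec_le _ _ k2l) (estim_rec_le _ _ k2r)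
  (@bound_p l.+1 _ lL k2l) childl childr.
move=> /(_ isT isT) step.
have beta0 : 0 <= beta - kappa / (rho - 1) by exact: le_trans (frob_ge0 _) childl.
have -> : frob (estim_rec S T r Pr phat e k - sketched T pstar l k) =
    tfrob (fun g => estim_rec S T r Pr phat (level_succ e) k.*2
        *m Gmx S T r Pr phat k lL g
        *m (estim_rec S T r Pr phat (level_succ e) k.*2.+1)^T
      - sketched T pstar l.+1 k.*2 *m exact_core k lL g
        *m (sketched T pstar l.+1 k.*2.+1)^T).
  rewrite (frob_slice lL); apply: eq_tfrob => g.
  rewrite sliceB (slice_recover lL kl) /= (bool_irrelevance (level_lt e) lL).
  by rewrite slice_merge.
have core := exact_core_le lL kl; have hk := hkappa _ _ lL kl.
have c0 := cpt_ge0; have p0 := cp_ge0.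
have step2 : (cpt + cp) * (beta - kappa / (rho - 1)) * tfrob (exact_core k lL) <=
    rho * (beta - kappa / (rho - 1)).
  apply: le_trans (ler_wpM2l _ core) _; first by rewrite mulr_ge0 // addr_ge0.
  rewrite le_eqVlt; apply/orP; left; apply/eqP; rewrite /rho; ring.
have fixpoint : kappa + kappa / (rho - 1) = rho * (kappa / (rho - 1)).
  by field; rewrite subr_eq0 gt_eqF.
rewrite exprS -mulrA -/beta.
have -> : rho * beta = rho * (beta - kappa / (rho - 1)) + (kappa + kappa / (rho - 1)).
  by rewrite fixpoint -mulrDr subrK.
by rewrite addrA lerD2r addrC (le_trans step) // lerD.
Qed.

Lemma tnorm_estimator :
  tnorm (fun x => estimator S T r Pr phat rt0 x - pstar x) =
  frob (estim_mx S T r Pr phat (leq0n L) 0 - sketched T pstar 0 0).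
Proof.
have subE m1 m2 (M N : 'M[R]_(m1, m2)) i j : (M - N) i j = M i j - N i j.
  by rewrite !mxE.
rewrite -tnorm_top; congr Num.sqrt; apply: eq_bigr => x _.
by rewrite subE sketched_top.
Qed.

Lemma frob_sketched_top : frob (sketched T pstar 0 0) = tnorm pstar.
Proof.
by rewrite -tnorm_top; congr Num.sqrt; apply: eq_bigr => x _; rewrite sketched_top.
Qed.

(** Recovery factors [pstar] through the pseudo-inverses and the sketched
    children, hence a norm at most [(cA * cp) ^+ 2] times its own. *)
Lemma cA_cp_ge1 : 0 < tnorm pstar -> 1 <= cA * cp.
Proof.
move=> p0; have k2 : (0 < 2 ^ 0)%N by [].
have [k2l k2r] := level_child k2.
have a0 := cA_ge0; have c0 := cp_ge0.
have pl : specnorm (sketched T pstar 1 0.*2) <= cp.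
  by apply: le_trans (specnorm_le_frob _) _; apply: bound_p.
have pr : specnorm (sketched T pstar 1 0.*2.+1) <= cp.
  by apply: le_trans (specnorm_le_frob _) _; apply: bound_p.
have hG : tfrob (exact_core 0 L_ge1) <= cA * cA * tnorm pstar.
  rewrite -frob_sketched_top.
  apply: le_trans (tfrob_sandwich _ (bound_A _ k2l) (bound_A _ k2r)) _ => //.
  by rewrite ler_wpM2l ?mulr_ge0 ?frob_slice_sketch.
have hp : tnorm pstar <= cp * cp * tfrob (exact_core 0 L_ge1).
  rewrite -[leLHS]frob_sketched_top (frob_slice L_ge1).
  rewrite (eq_tfrob (slice_recover L_ge1 k2)); exact: tfrob_sandwich.
have : tnorm pstar <= (cA * cp) ^+ 2 * tnorm pstar.
  apply: le_trans hp _; apply: le_trans (ler_wpM2l _ hG) _; first by rewrite mulr_ge0.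
  lra.
rewrite -{1}[tnorm pstar]mul1r ler_pM2r // => h.
by apply: le_of_sqr; rewrite ?mulr_ge0 // expr1n.
Qed.

Lemma estim_top_le :
  frob (estim_mx S T r Pr phat (leq0n L) 0) <= cpt ^+ 2 * (cAh ^+ 2 * (cp + eta)).
Proof.
have [j jL] : exists j, (0 + j.+1)%N = L by exists L.-1; rewrite add0n prednK.
have k2 : (0 < 2 ^ 0)%N by []; have [k2l k2r] := level_child k2.
rewrite -(estim_recE jL) (frob_slice (level_lt jL)).
rewrite (@eq_tfrob _ _ _ _ _ (fun g => estim_rec S T r Pr phat (level_succ jL) 0.*2
    *m Gmx S T r Pr phat 0 (level_lt jL) g
    *m (estim_rec S T r Pr phat (level_succ jL) 0.*2.+1)^T)); last first.
  by move=> g; rewrite slice_merge.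
have spec k : (k < 2 ^ 1)%N ->
    specnorm (estim_rec S T r Pr phat (level_succ jL) k) <= cpt.
  by move=> k1; apply: le_trans (specnorm_le_frob _) _; rewrite estim_rec_le.
apply: le_trans (tfrob_sandwich _ (spec _ k2l) (spec _ k2r)) _.
by rewrite -expr2 ler_wpM2l ?sqr_ge0 ?Gmx_le.
Qed.

(** If [eta * cA <= 4 / 9], the pseudo-inverses are stable and the errors
    propagate along the tree. Otherwise [1 <= eps * cA], and the bound follows
    from the triangle inequality and the crude bounds on the two norms. *)
Lemma estimator_error eps : 0 < tnorm pstar -> 9 / 4 * eta <= eps ->
  tnorm (fun x => estimator S T r Pr phat rt0 x - pstar x) <=
  eps * (rho ^+ L * (1 + cpt ^+ 2 * (cAh ^+ 2 + 6 * cA * cAh ^+ 2 * cp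
                      + 6 * cA ^+ 2 * cAh * cp) / (rho - 1))).
Proof.
move=> p0 eps_eta; rewrite tnorm_estimator.
have e0 := sampling_error_ge0; have a0 := cA_ge0; have b0 := cAh_ge0.
have c0 := cp_ge0; have t0 := cpt_ge0; have ac1 := cA_cp_ge1 p0.
have t2 : 0 <= cpt ^+ 2 by exact: sqr_ge0.
have b2 : 0 <= cAh ^+ 2 by exact: sqr_ge0.
have r1 : 0 < rho - 1 by rewrite subr_gt0.
have r0 : 0 < rho by apply: lt_trans rho_gt1.
have eps0 : 0 <= eps by lra.
set K := cAh ^+ 2 + 6 * cA * cAh ^+ 2 * cp + 6 * cA ^+ 2 * cAh * cp.
have u0 : 0 <= cA * cAh ^+ 2 * cp by rewrite !mulr_ge0.
have v0 : 0 <= cA ^+ 2 * cAh * cp by rewrite !mulr_ge0 ?sqr_ge0.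
have K0 : 0 <= K by rewrite /K; lra.
have [etaA|etaA] := leP (eta * cA) (4 / 9).
  pose K' := cAh ^+ 2 + 11 * cA * cAh ^+ 2 * cp + 11 * cA ^+ 2 * cAh * cp.
  have K'0 : 0 <= K' by rewrite /K'; lra.
  have K'K : K' * eta <= K * eps.
    (* 11 <= 6 * (9 / 4): the slack between eta and eps pays for the constants *)
    have h : K * (9 / 4 * eta) <= K * eps by apply: ler_wpM2l.
    apply: le_trans h; rewrite mulrCA mulrA ler_wpM2r // /K /K'; lra.
  have := @estim_rec_error (cpt ^+ 2 * (K' * eta)) L 0 (add0n L) 0 isT.
  rewrite (estim_recE _ (leq0n L)) => main.
  have {main} : frob (estim_mx S T r Pr phat (leq0n L) 0 - sketched T pstar 0 0)
      + cpt ^+ 2 * (K' * eta) / (rho - 1)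
      <= rho ^+ L * (eta + cpt ^+ 2 * (K' * eta) / (rho - 1)).
    by apply: main => l k lL kl; apply: ler_wpM2l => //; exact: Gmx_close.
  set x := frob _ => main.
  have {}main : x <= rho ^+ L * (eta + cpt ^+ 2 * (K' * eta) / (rho - 1)).
    apply: le_trans main; rewrite lerDl.
    by rewrite divr_ge0 ?(ltW r1) ?mulr_ge0.
  apply: le_trans main _; rewrite [leRHS]mulrCA ler_wpM2l ?exprn_ge0 ?(ltW r0) //.
  rewrite mulrDr mulr1 lerD //; first lra.
  rewrite [leRHS]mulrA ler_wpM2r ?invr_ge0 ?(ltW r1) //.
  by rewrite [leRHS]mulrCA ler_wpM2l // [eps * _]mulrC.
have eps_cA : 1 <= cA * eps.
  have : cA * (9 / 4 * eta) <= cA * eps by rewrite ler_wpM2l.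
  lra.
apply: le_trans (frobB _ _) _; rewrite frob_sketched_top.
apply: le_trans (lerD estim_top_le bound_pstar) _.
have h1 : cp <= rho * eps.
  have s1 : cp <= cp * (cA * cp) by rewrite ler_peMr.
  have s2 : cp * (cA * cp) <= cp * (cA * cp) * (cA * eps).
    by rewrite ler_peMr ?mulr_ge0.
  have s3 : 0 <= cA ^+ 2 * cp * cpt * eps by rewrite !mulr_ge0 ?sqr_ge0.
  have : rho * eps = cA ^+ 2 * cp * cpt * eps + cp * (cA * cp) * (cA * eps).
    by rewrite /rho; ring.
  lra.
have h2 : cAh ^+ 2 * (cp + eta) <= K * eps.
  have s1 : cAh ^+ 2 * cp <= cAh ^+ 2 * cp * (cA * eps).
    by rewrite ler_peMr ?mulr_ge0.
  have s2 : cAh ^+ 2 * eta <= cAh ^+ 2 * eps by rewrite ler_wpM2l //; lra.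
  have s3 : 0 <= cA * cAh ^+ 2 * cp * eps by rewrite mulr_ge0.
  have s4 : 0 <= cA ^+ 2 * cAh * cp * eps by rewrite mulr_ge0.
  rewrite /K; lra.
have rL : rho <= rho ^+ L.
  by rewrite -{1}[rho]expr1 ler_weXn2l // ltW.
have h3 : cpt ^+ 2 * (cAh ^+ 2 * (cp + eta)) <= cpt ^+ 2 * (K * eps).
  by rewrite ler_wpM2l.
have kap : 0 <= cpt ^+ 2 * (K * eps) by rewrite !mulr_ge0.
have h4 : rho * eps <= rho ^+ L * eps by rewrite ler_wpM2r.
have h5 : cpt ^+ 2 * (K * eps) <= rho ^+ L * (cpt ^+ 2 * (K * eps) / (rho - 1)).
  by rewrite [leRHS]mulrA ler_pdivlMr // mulrC ler_wpM2r //; lra.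
have -> : eps * (rho ^+ L * (1 + cpt ^+ 2 * K / (rho - 1))) =
    rho ^+ L * eps + rho ^+ L * (cpt ^+ 2 * (K * eps) / (rho - 1)).
  by field; rewrite gt_eqF.
lra.
Qed.

End ErrorPropagation.

(** * Samples of independent draws *)

Section Sample.
Context {R : realType} (d : measure_display) (Om : measurableType d).
Variables (P : probability Om R) (X : finType) (N : nat).
Variables (y : 'I_N -> Om -> X) (p : X -> R).
Hypothesis y_iid : iid P y p.

Definition sample w : N.-tuple X := [tuple y i w | i < N].

Lemma sample_eqE t : [set w | sample w = t] =
  \bigcap_(i in [set` [set: 'I_N]%SET]) (y i @^-1` [set tnth t i]).
Proof.
apply/seteqP; split => [w /= <- i _|w /= h]; first by rewrite /= tnth_mktuple.
apply: eq_from_tnth => i; rewrite tnth_mktuple; apply: h => /=.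
by rewrite finset.in_setT.
Qed.

Lemma measurable_sample (Q : set (N.-tuple X)) : measurable [set w | Q (sample w)].
Proof.
have [y_meas _ _] := y_iid.
have -> : [set w | Q (sample w)] = \bigcup_(t in Q) [set w | sample w = t].
  by apply/seteqP; split => [w Qw|w [t Qt /= ->]] //; exists (sample w).
apply: fin_bigcup_measurable => // t _; rewrite sample_eqE.
by apply: fin_bigcap_measurable => // i _.
Qed.

Lemma probability_sample (Q : pred (N.-tuple X)) :
  P [set w | Q (sample w)] = (\sum_(t | Q t) \prod_(x <- t) p x)%:E.
Proof.
have [y_meas y_p y_indep] := y_iid.
have -> : [set w | Q (sample w)] = \bigcup_(t in [set` Q]) [set w | sample w = t].
  by apply/seteqP; split => [w Qw|w [t Qt /= ->]] //; exists (sample w).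
have triv : trivIset [set` Q] (fun t => [set w | sample w = t]).
  by move=> t t' _ _ [w [/= -> ->]].
rewrite (measure_fin_bigcup P _ triv) //; last first.
  by move=> t _; exact: (measurable_sample [set t]).
rewrite -(@bigfs _ _ _ _ (index_enum {: N.-tuple X})) ?index_enum_uniq //; last first.
  by move=> t _; rewrite mem_index_enum.
rewrite -sumEFin; apply: eq_bigr => t _.
rewrite sample_eqE; apply: etrans (y_indep _ (fun i => [set tnth t i])) _.
rewrite big_tuple; congr (_%:E).
rewrite (eq_bigl xpredT) => [|i]; last by rewrite finset.in_setT.
by apply: eq_bigr => i _; rewrite y_p.
Qed.

Lemma empirical_deviation (w : Om) : (0 < N)%N ->
  l2 (fun x => #|[set i | y i w == x]%SET|%:R / N%:R - p x) =
  count_deviation p (sample w) / N%:R.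
Proof.
move=> N0; have N0' : (N%:R : R) != 0 by rewrite pnatr_eq0 -lt0n.
rewrite mulrC -l2Z ?invr_ge0 //; apply: eq_l2 => x.
rewrite big_tuple; under eq_bigr do rewrite tnth_mktuple.
rewrite sumrB sumr_const card_ord -mulr_natl.
have -> : \sum_(i < N) (y i w == x)%:R = #|[set i | y i w == x]%SET|%:R :> R.
  rewrite -sum1_card natr_sum [RHS]big_mkcond; apply: eq_bigr => i _.
  by rewrite inE; case: (y i w == x).
by field.
Qed.

End Sample.

Section ProbabilityMassFunction.
Context {R : realType} (X : finType) (p : X -> R).
Hypotheses (p_ge0 : forall x, 0 <= p x) (p_sum1 : \sum_x p x = 1).

Lemma pmf_support : exists x, 0 < p x.
Proof.
have : \sum_x p x != 0 by rewrite p_sum1 oner_eq0.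
by move=> /eqP/(psumr_neq0P (fun x _ => p_ge0 x))[x /= px]; exists x.
Qed.

Lemma l2_pmf_gt0 : 0 < l2 p.
Proof.
have [x px] := pmf_support; rewrite sqrtr_gt0 (bigD1 x) //=.
by rewrite ltr_pwDl ?exprn_gt0 // sumr_ge0 // => i _; exact: sqr_ge0.
Qed.

End ProbabilityMassFunction.

Theorem theorem6 (R : realType) (L : nat) (n : 'I_(2 ^ L) -> nat)
    (pstar : tidx n -> R)
    (disp : measure_display) (Om : measurableType disp) (P : probability Om R)
    (N : nat) (y : 'I_N -> Om -> tidx n)
    (rt : nat -> nat)
    (S : forall l k : nat, 'M[R]_(#|{: Iidx n l k}|, rt l))
    (T : forall l k : nat, 'M[R]_(#|{: Jidx n l k}|, rt l))
    (r : nat -> nat)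
    (Pr : nat -> forall m1 m2 : nat, 'M[R]_(m1, m2) -> 'M[R]_(m1, m2))
    (cA cAh cp cpt delta : R)
    (L_ge1 : (1 <= L)%N) (N_ge1 : (1 <= N)%N)
    (rt0 : rt 0%N = 1%N)
    (r_le_rt : forall l, (1 <= l <= L)%N -> (r l <= rt l)%N)
    (Pr_best : forall (s m1 m2 : nat) (M : 'M[R]_(m1, m2)),
      best_rank_approx s M (Pr s m1 m2 M))
    (pstar_pmf : pmf pstar)
    (y_iid : iid P y pstar)
    (rank_pstar : forall l k, (1 <= l <= L)%N -> (k < 2 ^ l)%N ->
      \rank (unfold pstar l k) = r l)
    (range_T : forall l k, (1 <= l <= L)%N -> (k < 2 ^ l)%N ->
      range_eq (unfold pstar l k *m T l k) (unfold pstar l k))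
    (range_S : forall l k, (1 <= l <= L)%N -> (k < 2 ^ l)%N ->
      range_eq ((unfold pstar l k)^T *m S l k) (unfold pstar l k)^T)
    (range_children : forall l k (lL : (l < L)%N), (k < 2 ^ l)%N ->
      let Z := slice lL (sketched T pstar l k) in
      range_sub (unfold3 Z) (sketched T pstar l.+1 k.*2) /\
      range_sub (unfold3 (fun g => (Z g)^T)) (sketched T pstar l.+1 k.*2.+1))
    (orthonormal_sketches : forall l k, (1 <= l <= L)%N -> (k < 2 ^ l)%N ->
      orthonormal_cols (S l k) /\ orthonormal_cols (T l k))
    (bound_A : forall l k, (1 <= l <= L)%N -> (k < 2 ^ l)%N ->
      specnorm (pinv (Amx S T pstar l k)) <= cA)
    (bound_Ahat : {ae P, forall w, forall l k,
      (1 <= l <= L)%N -> (k < 2 ^ l)%N ->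
      specnorm (pinv (PAmx S T r Pr (empirical (y ^~ w)) l k)) <= cAh})
    (bound_p : forall l k, (1 <= l <= L)%N -> (k < 2 ^ l)%N ->
      frob (sketched T pstar l k) <= cp)
    (bound_ptilde : {ae P, forall w, forall l k (lL : (l <= L)%N),
      (1 <= l)%N -> (k < 2 ^ l)%N ->
      frob (estim_mx S T r Pr (empirical (y ^~ w)) lL k) <= cpt})
    (bound_pstar : tnorm pstar <= cp)
    (delta_range : 0 < delta < 1)
    (rho_gt1 : 1 < cA ^+ 2 * cp * cpt + cA ^+ 2 * cp ^+ 2) :
  let rmax : R := (\max_(l < L) rt l.+1)%:R in
  let rho := cA ^+ 2 * cp * cpt + cA ^+ 2 * cp ^+ 2 in
  let Ctilde := 3 * Num.sqrt rmax *
    (1 + cpt ^+ 2 * (cAh ^+ 2 + 6 * cA * cAh ^+ 2 * cp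
                     + 6 * cA ^+ 2 * cAh * cp) / (rho - 1)) in
  ((1 - delta)%:E <=
   P [set w |
      (tnorm (fun x => estimator S T r Pr (empirical (y ^~ w)) rt0 x - pstar x)
       <= Ctilde * rho ^+ L *
          (ln (2 * rmax * (2 ^ L)%:R * L%:R / delta) / Num.sqrt N%:R))%R])%E.
Proof.
cbv zeta; set rmax : R := (\max_(l < L) rt l.+1)%:R.
set rho := cA ^+ 2 * cp * cpt + cA ^+ 2 * cp ^+ 2.
set Ctilde := 3 * Num.sqrt rmax * _; set event := [set w | _].
have [pstar_ge0 pstar_sum1] := pstar_pmf.
have [x0 _] := pmf_support pstar_ge0 pstar_sum1.
have inh : inhabited (tidx n) by exists.
have pstar_gt0 : 0 < tnorm pstar := l2_pmf_gt0 pstar_ge0 pstar_sum1.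
have rmax_ge1 : 1 <= rmax.
  rewrite /rmax ler1n; apply: leq_trans (leq_bigmax (Ordinal L_ge1)) => /=.
  apply: leq_trans (r_le_rt 1%N _) => //.
  rewrite -(@rank_pstar 1%N 0%N) // lt0n mxrank_eq0; apply/eqP => u0.
  by move: pstar_gt0; rewrite -(frob_unfold pstar 1 0) u0 frob0 ltxx.
pose arg := 2 * rmax * (2 ^ L)%:R * L%:R / delta; pose t := ln arg.
pose q : R := Num.sqrt N%:R; pose eps := 3 * Num.sqrt rmax * (t / q).
have N0 : 0 < N%:R :> R by rewrite ltr0n.
have q0 : 0 < q by rewrite sqrtr_gt0.
have q2 : q ^+ 2 = N%:R by rewrite sqr_sqrtr // ltW.
have [delta0 delta1] := andP delta_range.
have arg_ge : 4 / delta <= arg.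
  rewrite ler_wpM2r ?invr_ge0 ?(ltW delta0) //.
  have L1 : 1 <= L%:R :> R by rewrite ler1n.
  have L2 : 2 <= (2 ^ L)%:R :> R by rewrite ler_nat -{1}(expn1 2) leq_exp2l.
  rewrite -[4]mulr1; apply: ler_pM => //.
  have -> : 4 = 2 * 1 * 2 :> R by ring.
  by apply: ler_pM => //; apply: ler_pM.
have arg0 : 0 < arg by apply: lt_le_trans arg_ge; rewrite divr_gt0.
have t0 : 0 <= t.
  apply: ln_ge0; apply: le_trans arg_ge; rewrite ler_pdivlMr // mul1r.
  by rewrite (le_trans (ltW delta1)) // ler1n.
(* the logarithm contains 2 * rmax * 2 ^ L * L >= 4, which absorbs the factor 4
   of the tail bound *)
have tail : 4 * expR (- (Num.sqrt rmax * t)) <= delta.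
  apply: (@le_trans _ _ (4 * expR (- t))).
    rewrite ler_wpM2l // ler_expR lerN2 ler_peMl //.
    by rewrite -[1]sqrtr1 ler_sqrt // ltW // (lt_le_trans ltr01).
  by rewrite expRN lnK ?posrE // ler_pdivrMr // mulrC -ler_pdivrMr.
pose bad := [set w | 4 / 9 * eps * N%:R < count_deviation pstar (sample y w)].
have bad_meas : measurable bad.
  exact: (measurable_sample y_iid [set s | 4 / 9 * eps * N%:R < count_deviation pstar s]).
(* the event depends on the sample only, which takes finitely many values *)
have event_meas : measurable event.
  pose f (s : N.-tuple (tidx n)) := estimator S T r Pr (empirical (tnth s)) rt0.
  have -> : event = [set w | [set s | tnorm (fun x => f s x - pstar x)
      <= Ctilde * rho ^+ L * (t / q)] (sample y w)].
    apply/seteqP; suff fE w : f (sample y w) =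
        estimator S T r Pr (empirical (y ^~ w)) rt0.
      by split => w; rewrite /event /= fE.
    rewrite /f; have -> // : tnth (sample y w) = y ^~ w.
    by apply/funext => i; rewrite tnth_mktuple.
  exact: (measurable_sample y_iid [set s | tnorm (fun x => f s x - pstar x)
      <= Ctilde * rho ^+ L * (t / q)]).
have bad_le : (P bad <= delta%:E)%E.
  rewrite (probability_sample y_iid
    (fun s => 4 / 9 * eps * N%:R < count_deviation pstar s)) lee_fin.
  apply: le_trans (count_deviation_tail pstar_ge0 pstar_sum1 _ N_ge1) _.
  apply: le_trans tail; rewrite ler_wpM2l // ler_expR lerN2 le_eqVlt.
  apply/orP; left; apply/eqP; rewrite -/q -q2 /eps; field; exact: lt0r_neq0.
have [NA [NA_meas PNA NA_sub]] := bound_Ahat.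
have [Np [Np_meas PNp Np_sub]] := bound_ptilde.
have good_sub : ~` bad `<=` event `|` (NA `|` Np).
  move=> w /= good.
  have [hA|hA] := pselect (NA w); first by right; left.
  have [hp|hp] := pselect (Np w); first by right; right.
  have {}hA := contra_notP (NA_sub w) hA.
  have {}hp := contra_notP (Np_sub w) hp.
  left; rewrite /event /=.
  have -> : Ctilde * rho ^+ L * (t / q) = eps * (rho ^+ L * (1 + cpt ^+ 2 *
      (cAh ^+ 2 + 6 * cA * cAh ^+ 2 * cp + 6 * cA ^+ 2 * cAh * cp) / (rho - 1))).
    by rewrite /Ctilde /eps; ring.
  apply: estimator_error => //.
  have -> : sampling_error pstar (empirical (y ^~ w)) =
      count_deviation pstar (sample y w) / N%:R := empirical_deviation y pstar w N_ge1.
  move/negP: good; rewrite -leNgt -ler_pdivrMr // => good.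
  lra.
have PU : (P (~` bad) <= P event)%E.
  apply: le_trans (le_measure P _ _ good_sub) _; rewrite ?inE.
  - exact: measurableC.
  - by apply: measurableU => //; exact: measurableU.
  apply: le_trans (measureU2 _ _ _) _ => //; first exact: measurableU.
  rewrite -[leRHS]adde0 leeD2l //.
  apply: le_trans (measureU2 _ NA_meas Np_meas) _.
  have null : (P NA + P Np <= 0)%E by rewrite PNA PNp adde0.
  exact: null.
apply: le_trans PU; rewrite probability_setC // EFinB leeB //.
Qed.
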